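(* Fix $p\in(0,1)$. Let $\pi_{\mathrm{NOB}}$ be the no-job-left-behind policy. (1) $\pi_{\mathrm{NOB}}$ is feasible for all $\lambda\in(1-p,1)$, and $$C(p,\lambda,\pi_{\mathrm{NOB}})=\frac{1-p}{\lambda-(1-p)} .$$ (2) $\pi_{\mathrm{NOB}}$ is asymptotically optimal in the class $\Pi_\infty$ of offline policies as $\lambda\to1$: $$\lim_{\lambda\to1}C(p,\lambda,\pi_{\mathrm{NOB}})=\lim_{\lambda\to1}C^*_{\Pi_\infty}(p,\lambda)=\frac{1-p}{p}.$$
   Context: Model. Fix $p\in(0,1)$, $\lambda\in(0,1)$. Jobs arrive to a single queue (unbounded buffer, empty at time $0$) according to a Poisson process of rate $\lambda$; service tokens are generated by an independent Poisson process of rate $1-p$. Without deletions, each arrival increases the queue length by 1; each token decreases it by 1 if the queue is nonempty and otherwise is wasted (no effect). Let $Q^0(t)\in\mathbb{Z}_+$, $t\ge 0$, be the (right-continuous) queue length process without deletions. An event is an arrival or a token generation (wasted or not); $T_n$ is the time of the $n$th event, and $Q^0[n]$ is the queue length immediately after the $n$th event, $Q^0[0]=0$. The path $Q^0$ is called the initial sample path. Deletions. For a discrete-time path $Q$, $\Phi(Q)=\{n\in\mathbb{N}: Q[n]>Q[n-1]\}$ is the set of arrival slots. For $M\subset\mathbb{Z}_+$, $I(M,n)=|\{1,\dots,n\}\cap M|$. A sequence $M=\{m_i\}$ (possibly finite) is a feasible deletion sequence for $Q^0$ if its elements are distinct, $M\subset\Phi(Q^0)$, and $\limsup_{n\to\infty}\frac1n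 I(M,n)\le\frac{p}{\lambda+1-p}$ almost surely. The point-wise deletion map $D_P(Q,m)=Q'$ is given by $Q'[n]=Q[n]-1$ if $n\ge m$ and $Q[t]>0$ for all $t\in\{m,\dots,n\}$, and $Q'[n]=Q[n]$ otherwise. The multi-point deletion map $D(Q^0,M)$ is the pointwise limit (over $i\to |M|$ or $\infty$) of $Q^i=D_P(Q^{i-1},m_i)$. Policies. The sample path of $Q^0$ is regarded as containing all relevant information on arrivals and tokens (in particular the event times). For $w\in\mathbb{R}_+\cup\{\infty\}$, let $\mathcal{F}_t=\sigma(Q^0(s);s\le t)$ and $\mathcal{F}_\infty=\bigcup_t\mathcal{F}_t$. A $w$-lookahead deletion policy is a mapping $\pi$ of the path $Q^0$ to a sequence $M=\pi(Q^0)$ (possibly using internal randomness) such that $M$ is a feasible deletion sequence a.s., and the event $\{n\in M\}$ is $\mathcal{F}_{T_n+w}$-measurable for all $n\in\mathbb{N}$. $\Pi_w$ is the set of all $w$-lookahead policies; $\Pi_\infty$ is the class of offline policies (the entire path is known at time $0$). A policy is called feasible if the deletion sequence it outputs is a feasible deletion sequence a.s. Performance. $C(p,\lambda,\pi)=\mathbb{E}\bigl(\limsup_{n\to\infty}\frac1n\sum_{k=1}^n Q_\pi^\infty[k]\bigr)$ with $Q^\infty_\pi=D(Q^0,\pi(Q^0))$, the expectation being over $Q^0$ and any internal randomness of $\pi$. $C^*_{\Pi_w}(p,\lambda)=\inf_{\pi\in\Pi_w}C(p,\lambda,\pi)$. No-job-left-behind policy. Let $U(Q,n)=\inf\{j\ge1: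 Q[n+j]=Q[n]-1\}$ (with $\inf\varnothing=\infty$). $\pi_{\mathrm{NOB}}$ deletes exactly the arrivals in the set $\Psi=\{n\in\Phi(Q^0): U(Q^0,n)=\infty\}$. *)

(* Defs.v *)
From HB Require Import structures.
From mathcomp Require Import all_boot all_order all_algebra finmap.
From mathcomp Require Import all_classical all_reals all_analysis.

Set Implicit Arguments.
Unset Strict Implicit.
Unset Printing Implicit Defensive.

Import Order.TTheory GRing.Theory Num.Theory.
Import numFieldTopology.Exports numFieldNormedType.Exports.

Local Open Scope classical_set_scope.
Local Open Scope ring_scope.

(** * Deletion maps on discrete-time paths *)

(* All averages start at n = 0, where division by zero returns 0; this does
   not affect a limsup. *)
Definition limsup_avg (R : realType) (u : nat -> nat) : \bar R :=
  limn_esup (fun n => ((u n)%:R / n%:R)%:E).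

Definition arrival_slots (Q : nat -> nat) : set nat :=
  [set n | (0 < n)%N /\ (Q n.-1 < Q n)%N].

(* A finite or infinite sequence of slots.  A step at which the sequence is
   [None] deletes nothing, so a finite sequence is padded with [None]. *)
Definition deletion_seq := nat -> option nat.

Definition deleted (M : deletion_seq) : set nat :=
  [set m | exists i, M i = Some m].

Definition num_deleted (M : deletion_seq) (n : nat) : nat :=
  count (fun m => `[< deleted M m >]) (iota 1 n).

(* The almost sure clause of feasibility is expressed by requiring this
   predicate for almost every outcome; see [feasible_policy]. *)
Definition feasible_deletion (R : realType) (p lambda : R)
    (Q : nat -> nat) (M : deletion_seq) : Prop :=
  [/\ forall i j m, M i = Some m -> M j = Some m -> i = j,
      deleted M `<=` arrival_slots Q &
      (limsup_avg R (num_deleted M) <= (p / (lambda + 1 - p))%:E)%E].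

Definition point_deletion (Q : nat -> nat) (m : nat) : nat -> nat :=
  fun n => if (m <= n)%N && all (fun t => 0 < Q t)%N (index_iota m n.+1)
           then (Q n).-1 else Q n.

Fixpoint delete_first (Q : nat -> nat) (M : deletion_seq) (i : nat) :
    nat -> nat :=
  if i is j.+1 then
    if M j is Some m then point_deletion (delete_first Q M j) m
    else delete_first Q M j
  else Q.

(* The limit is taken in the discrete space [nat]; it always exists, the
   paths [delete_first Q M i] being pointwise nonincreasing in [i]. *)
Definition multi_deletion (Q : nat -> nat) (M : deletion_seq) : nat -> nat :=
  fun n => lim (delete_first Q M i n @[i --> \oo]).

(* [Q (n + j)] is the predecessor of [Q n] in the integers: there is no such
   [j] when [Q n = 0]. *)
Definition first_descent (R : realType) (Q : nat -> nat) (n : nat) : \bar R :=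
  ereal_inf [set (j%:R : R)%:E | j in
    [set j : nat | (1 <= j)%N /\ (Q (n + j)%N).+1 = Q n]].

Definition left_behind (R : realType) (Q : nat -> nat) : set nat :=
  [set n | arrival_slots Q n /\ first_descent R Q n = +oo%E].

(** * The queue without deletions *)

(* The arrival and token counting functions: [(x t).1] arrivals and [(x t).2]
   tokens, wasted or not, during [0, t].  Values at negative times are never
   used. *)
Definition sample_path (R : realType) := R -> nat * nat.

Definition num_events (R : realType) (x : sample_path R) (t : R) : nat :=
  ((x t).1 + (x t).2)%N.

Definition event_time (R : realType) (x : sample_path R) (n : nat) : R :=
  inf [set t : R | 0 <= t /\ (n <= num_events x t)%N].

(* The [n.+1]-st event is an arrival iff the arrival counter increases between
   the [n]-th and the [n.+1]-st event; simultaneous events have probability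
   zero.  The predecessor of 0 is 0: a token is wasted on an empty queue. *)
Fixpoint initial_path (R : realType) (x : sample_path R) (n : nat) : nat :=
  if n is k.+1 then
    if ((x (event_time x k)).1 < (x (event_time x k.+1)).1)%N
    then (initial_path x k).+1 else (initial_path x k).-1
  else 0%N.

Definition queue_length (R : realType) (x : sample_path R) (t : R) : nat :=
  initial_path x (num_events x t).

(** * Probabilistic model *)

(* The sigma-algebra generated by [X t], t in [D], for [X t] with values in a
   countable set. *)
Definition generated_by (R : realType) (T V : Type) (D : set R)
    (X : T -> R -> V) : set (set T) :=
  <<s [set E | exists t v, D t /\ E = [set w | X w t = v]] >>.

Definition mutually_independent d (T : measurableType d) (R : realType)
    (P : probability T R) (X : nat -> {RV P >-> R}) : Prop :=
  forall (J : {fset nat}) (B : nat -> set R), (forall i, measurable (B i)) ->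
    P (\bigcap_(i in [set` J]) (X i @^-1` B i)) =
    (\prod_(i <- J) P (X i @^-1` B i))%E.

(* A Poisson process counts the partial sums of i.i.d. exponential variables. *)
Definition poisson_process d (T : measurableType d) (R : realType)
    (P : probability T R) (rate : R) (N : T -> R -> nat) : Prop :=
  exists X : nat -> {RV P >-> R},
    [/\ mutually_independent X,
        forall i (B : set R), measurable B ->
          distribution P (X i) B = exponential_prob rate B &
        forall w (t : R) k, 0 <= t ->
          (k <= N w t)%N <-> \sum_(i < k) X i w <= t].

Definition independent_processes d (T : measurableType d) (R : realType)
    (P : probability T R) (N1 N2 : T -> R -> nat) : Prop :=
  forall E F : set T, generated_by [set t | 0 <= t] N1 E ->
    generated_by [set t | 0 <= t] N2 F -> P (E `&` F) = (P E * P F)%E.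

Record queue_model (R : realType) := QueueModel {
  model_display : measure_display;
  outcome : measurableType model_display;
  model_prob : probability outcome R;
  model_path : outcome -> sample_path R }.
Arguments model_path {R} _ _.

Definition is_queue (R : realType) (p lambda : R) (m : queue_model R) : Prop :=
  let arrivals := fun w t => (model_path m w t).1 in
  let tokens := fun w t => (model_path m w t).2 in
  [/\ poisson_process (model_prob m) lambda arrivals,
      poisson_process (model_prob m) (1 - p) tokens &
      independent_processes (model_prob m) arrivals tokens].

(* The queue length alone does not show the wasted tokens; the sample path of
   the queue carries all the information on arrivals and tokens. *)
Definition filtration (R : realType) (m : queue_model R) (t : R) :
    set (set (outcome m)) :=
  generated_by [set s | 0 <= s <= t]
    (fun w s => (queue_length (model_path m w) s, model_path m w s)).
Arguments filtration {R} _ _ _.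

Definition filtration_oo (R : realType) (m : queue_model R) :
    set (set (outcome m)) :=
  <<s \bigcup_(t in [set t | 0 <= t]) filtration m t >>.
Arguments filtration_oo {R} _ _.

(* For finite [w] this is the sigma-algebra of the stopping time
   [event_time n + w]. *)
Definition lookahead_info (R : realType) (m : queue_model R) (w : \bar R)
    (n : nat) : set (set (outcome m)) :=
  if w is r%:E%E then
    [set E | filtration_oo m E /\ forall t : R, 0 <= t ->
      filtration m t
        (E `&` [set o | event_time (model_path m o) n + r <= t])]
  else filtration_oo m.
Arguments lookahead_info {R} _ _ _ _.

(** * Policies *)

(* The internal randomness is a random element of [internal], independent of
   the queue. *)
Record policy (R : realType) := Policy {
  internal_display : measure_display;
  internal : measurableType internal_display;
  internal_prob : probability internal R;
  policy_map : sample_path R -> internal -> deletion_seq }.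
Arguments policy_map {R} _ _ _.

Section performance.
Variables (R : realType) (p lambda : R) (m : queue_model R).

Local Notation joint_prob pi := (model_prob m \x internal_prob pi)%E.

Definition policy_output (pi : policy R) (z : outcome m * internal pi) :
    deletion_seq :=
  policy_map pi (model_path m z.1) z.2.

Definition feasible_policy (pi : policy R) : Prop :=
  {ae joint_prob pi, forall z,
    feasible_deletion p lambda (initial_path (model_path m z.1))
      (policy_output z)}.

(* A predicate rather than a [set]: [policy R] is too large a type. *)
Definition lookahead_policy (w : \bar R) (pi : policy R) : Prop :=
  feasible_policy pi /\
  forall n, (0 < n)%N ->
    <<s [set A `*` B | A in lookahead_info m w n & B in measurable] >>
      [set z : outcome m * internal pi | deleted (policy_output z) n].

Definition cost (pi : policy R) : \bar R :=
  (\int[joint_prob pi]_z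
    limsup_avg R (fun n =>
      (\sum_(1 <= k < n.+1)
        multi_deletion (initial_path (model_path m z.1))
          (policy_output z) k)%N))%E.

Definition optimal_cost (w : \bar R) : \bar R :=
  ereal_inf [set c | exists pi, lookahead_policy w pi /\ cost pi = c].

End performance.

Definition no_job_left_behind (R : realType) : policy R :=
  Policy (dirac tt : probability unit R)
    (fun x _ n => if `[< left_behind R (initial_path x) n >] then Some n
                  else None).

(* Main.v *)
Require Import Defs.
From HB Require Import structures.
From mathcomp Require Import finmap.
From mathcomp Require Import all_boot all_order all_algebra.
From mathcomp Require Import all_classical all_reals all_analysis.
From mathcomp Require Import measurable_realfun simple_functions.
From mathcomp Require Import zify ring lra.

Import Order.TTheory GRing.Theory Num.Theory.
Import numFieldTopology.Exports numFieldNormedType.Exports.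

Local Open Scope classical_set_scope.
Local Open Scope ring_scope.

(** The slots of the queue without deletions are independent coin flips.  Arrivals
    and tokens are two independent Poisson processes, so each event is the outcome
    of a race between two memoryless clocks and is an arrival with probability
    q = lambda / (lambda + 1 - p), independently of the past: [queue_coin_flips].
    Everything else is about sequences of such bits, with q > 1/2, drift
    del = 2 * q - 1 and target value rho = (1 - q) / del, which is
    (1 - p) / (lambda - (1 - p)) by [optimal_backlog].

    Deleting the jobs left behind subtracts from the queue its future minimum.  What
    remains after a slot is at most the [backlog] of the bits after it, the largest
    excess of tokens over arrivals in a prefix of them, [nob_le_backlog].  Read
    backwards in time the backlog is a queue with arrival probability 1 - q and
    service probability q, which is stable.  Its fourth power has a negative drift,
    which bounds second moments; a martingale identity then shows that the sum of n
    backlogs has a mean squared distance of order n from rho * n, and [strong_law]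
    makes rho its almost sure rate.  The upper bound on the cost of no-job-left-behind follows
    by looking only slightly beyond a horizon, [nob_average].

    The lower bound holds on every path and for every deletion sequence, however
    clairvoyant.  To minimise the total queue length when each deletion is charged
    a price nu is a linear program, and [dual_bound] exhibits a feasible
    dual solution: a credit that is reset to nu at each arrival left behind and
    falls by one in every other slot until it is 0.  Up to a bounded term its value
    is nu for each arrival left behind plus the total backlog of the slots in which
    the credit is positive.  As jobs are left behind at the positive rate del, the
    credit seldom expires, and the backlog of the slots without credit is of order
    1 / nu per slot, [mean_late].  Hence a policy that deletes at a rate of at most
    K costs at least rho - nu * (K - del) - O(1 / nu), [cost_lower_bound].

    No-job-left-behind deletes at a rate of at most del, [nob_density], so letting nu
    tend to infinity gives it the cost rho exactly.  For a general policy K is the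
    budget p / (lambda + 1 - p), which exceeds del by (1 - lambda) / (lambda + 1 - p);
    this vanishes as lambda tends to 1, so that choosing nu large and then lambda
    close to 1 makes the lower bound meet rho, whose limit is (1 - p) / p.

    The cost of an arbitrary policy integrates a function of the outcome that need
    not be measurable.  The integral of a nonnegative function is the
    supremum of the integrals of the simple functions below it, so that measurable
    minorants bound it from below, and almost sure constant bounds from above. *)

(** * The race of two exponential clocks *)

Lemma measurable_lt_set d (T : measurableType d) (R : realType) (f g : T -> R) :
  measurable_fun setT f -> measurable_fun setT g ->
  measurable [set x | f x < g x].
Proof.
move=> mf mg.
have := measurable_fun_ltr mf mg measurableT (I : measurable [set true]).
by rewrite setTI preimage_true.
Qed.

Section race.
Context {R : realType}.
Notation mu := (@lebesgue_measure R).
Implicit Types (a b l m : R).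

Lemma measurable_EFin_exponential_pdf l (D : set R) : measurable_fun D (EFin \o (exponential_pdf l)).
Proof.
by apply: measurable_funTS; apply/measurable_EFinP; exact: measurable_exponential_pdf.
Qed.

Lemma exponential_prob_gt l a : 0 < l -> 0 <= a ->
  exponential_prob l `]a, +oo[%classic = (expR (- (l * a)))%:E.
Proof.
move=> l0 a0; rewrite /exponential_prob integral_itv_obnd_cbnd; last first.
  exact: measurable_EFin_exponential_pdf.
have cexp : continuous (fun z : R^o => expR (- l * z)).
  move=> z; apply: continuous_comp; last exact: continuous_expR.
  by apply: continuousM => //; apply: (@continuousN _ R^o); exact: cst_continuous.
rewrite (@ge0_continuous_FTC2y _ _ (fun x => - (expR (- l * x))) _ 0)//.
- by rewrite EFinN oppeK add0e mulNr.
- by move=> x _; apply: exponential_pdf_ge0; exact: ltW.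
- apply: (@continuous_subspaceW R^o _ _ [set` `[0, +oo[%R]).
    by move=> x /=; rewrite !in_itv/= !andbT; exact: le_trans.
  exact: within_continuous_exponential_pdf.
- rewrite -oppr0; apply: cvgN.
  rewrite (_ : (fun x => expR (- l * x)) =
               (fun z => expR (- z)) \o (fun z => l * z)); last first.
    by apply: eq_fun => x; rewrite mulNr.
  apply: (@cvg_comp _ _ _ _ _ _ (pinfty_nbhs R)); last exact: cvgr_expR.
  exact: gt0_cvgMry.
- by apply: cvgN; apply/cvg_at_right_filter; exact: cexp.
- move=> z; rewrite in_itv/= andbT => az.
  by apply: derive1_exponential_pdf; rewrite in_itv/= andbT (le_lt_trans a0).
Qed.

Section race_prob.
Variables (l m : R) (P1 P2 : probability R R).
Hypotheses (l0 : 0 < l) (m0 : 0 < m).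
Hypothesis P1E : forall B, measurable B -> P1 B = exponential_prob l B.
Hypothesis P2E : forall B, measurable B -> P2 B = exponential_prob m B.

Lemma race_survive a b : 0 <= a -> 0 <= b ->
  (P1 \x P2)%E [set z | a < z.1 /\ b < z.2] =
  (expR (- (l * a)) * expR (- (m * b)))%:E.
Proof.
move=> a0 b0.
have -> : [set z : R * R | a < z.1 /\ b < z.2] = `]a, +oo[ `*` `]b, +oo[.
  by apply/seteqP; split => -[x y] /=; rewrite !in_itv /= !andbT.
by rewrite product_measure1E//= P1E// P2E// !exponential_prob_gt.
Qed.

(** If the first clock rings at x > a, the second must survive until b + (x - a),
    which costs a factor exp (- m * (b + x - a)).  Integrating out the second clock
    first thus leaves an exponential density of rate l + m on the half-line above a. *)
Lemma race_first a b : 0 <= a -> 0 <= b ->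
  (P1 \x P2)%E [set z | [/\ a < z.1, b < z.2 & z.1 - a < z.2 - b]] =
  (l / (l + m) * (expR (- (l * a)) * expR (- (m * b))))%:E.
Proof.
move=> a0 b0; set A := [set z | _].
have mA : measurable A.
  have -> : A = [set z | a < z.1] `&` [set z | b < z.2] `&`
      [set z | z.1 - a < z.2 - b].
    by apply/seteqP; split => z /=; [case|case=> -[]].
  apply: measurableI; first apply: measurableI.
  - by apply: measurable_lt_set => //; exact: measurable_cst.
  - by apply: measurable_lt_set => //; exact: measurable_cst.
  - by apply: measurable_lt_set => //; apply: measurable_funB.
pose f (z : R * R) : \bar R := (exponential_pdf l z.1 * \1_A z)%:E.
have mf : measurable_fun setT f.
  apply/measurable_EFinP; apply: measurable_funM => //.
  exact: (measurableT_comp (measurable_exponential_pdf l)).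
have f0 z : (0%R <= f z)%E.
  by rewrite lee_fin mulr_ge0// exponential_pdf_ge0// ltW.
have -> : (P1 \x P2)%E A = (\int[P2]_y \int[mu]_x f (x, y))%E.
  transitivity ((P1 \x^ P2)%E A).
    by apply: product_measure_unique => //= ? ? ? ?; rewrite product_measure2E.
  apply: eq_integral => y _ /=.
  rewrite P1E; last exact: measurable_ysection.
  rewrite /exponential_prob integral_mkcond; apply: eq_integral => x _ /=.
  rewrite /f patchE /= mem_ysection indicE; case: ifPn => /= _.
    by rewrite mulr1.
  by rewrite mulr0.
rewrite -(@fubini_tonelli _ _ _ _ _ mu P2 f)//.
transitivity (\int[mu]_x ((l / (l + m) * expR (- (m * (b - a))))%:E *
   ((fun x => (exponential_pdf (l + m) x)%:E) \_ `]a, +oo[) x))%E.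
  apply: eq_integral => x _.
  rewrite /f /= patchE; case: ifPn => [|/negP]; rewrite inE /= in_itv /= andbT.
  - move=> ax; pose J : set R := `]b + (x - a), +oo[%classic.
    have mJ : measurable_fun setT (EFin \o (\1_J : R -> R)).
      by apply/measurable_EFinP; apply: measurable_indic; exact: measurable_itv.
    transitivity (\int[P2]_y ((exponential_pdf l x)%:E * (EFin \o \1_J) y))%E.
      apply: eq_integral => y _ /=; rewrite -EFinM !indicE; congr ((_ * _%:R)%:E).
      apply: congr1; apply/idP/idP; rewrite !inE /J /A /= in_itv /= andbT.
        by case=> _ _; rewrite ltrBrDl.
      move=> xy; split=> //; last by rewrite ltrBrDl.
      by apply: le_lt_trans xy; rewrite lerDl subr_ge0 ltW.
    rewrite ge0_integralZl//; last 2 first.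
    + by move=> y _; rewrite lee_fin.
    + by rewrite lee_fin exponential_pdf_ge0// ltW.
    rewrite integral_indic ?setIT//; last exact: measurable_itv.
    rewrite /= P2E; last exact: measurable_itv.
    rewrite /J exponential_prob_gt//; last first.
      by rewrite addr_ge0// subr_ge0 ltW.
    rewrite !exponential_pdfE ?(le_trans a0 (ltW ax))// -!EFinM; congr EFin.
    have lm0 : l + m != 0 by rewrite gt_eqF// addr_gt0.
    rewrite [RHS](_ : _ = l * (expR (- (m * (b - a))) * expR (- (l + m) * x))).
      by rewrite -mulrA -!expRD; congr (_ * expR _); ring.
    by field.
  - move=> /negP ax; rewrite [X in (_ * X)%E](_ : _ = 0%E)// mule0 integral0_eq// => y _.
    rewrite indicE memNset ?mulr0//= => -[]; by rewrite (negbTE ax).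
rewrite ge0_integralZl//.
- rewrite -integral_mkcond -/(exponential_prob _ _) exponential_prob_gt ?addr_gt0//.
  by rewrite -EFinM -(mulrA (l / (l + m))) -!expRD; congr ((_ * expR _)%:E); ring.
- apply/(measurable_restrictT _ _).1 => //.
  exact: measurable_EFin_exponential_pdf.
- move=> x _; apply: erestrict_ge0 => y _.
  by rewrite lee_fin exponential_pdf_ge0// ltW// addr_gt0.
- by rewrite lee_fin mulr_ge0// divr_ge0// ltW// addr_gt0.
Qed.

End race_prob.

Lemma race_second l m (P1 P2 : probability R R) a b : 0 < l -> 0 < m ->
  (forall B, measurable B -> P1 B = exponential_prob l B) ->
  (forall B, measurable B -> P2 B = exponential_prob m B) ->
  0 <= a -> 0 <= b ->
  (P1 \x P2)%E [set z | [/\ a < z.1, b < z.2 & z.2 - b < z.1 - a]] =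
  (m / (l + m) * (expR (- (l * a)) * expR (- (m * b))))%:E.
Proof.
move=> l0 m0 P1E P2E a0 b0; set A := [set z | _].
have mA : measurable A.
  have -> : A = [set z | a < z.1] `&` [set z | b < z.2] `&`
      [set z | z.2 - b < z.1 - a].
    by apply/seteqP; split => z /=; [case|case=> -[]].
  apply: measurableI; first apply: measurableI.
  - by apply: measurable_lt_set => //; exact: measurable_cst.
  - by apply: measurable_lt_set => //; exact: measurable_cst.
  - by apply: measurable_lt_set => //; apply: measurable_funB.
transitivity ((P1 \x^ P2)%E A).
  by apply: product_measure_unique => //= ? ? ? ?; rewrite product_measure2E.
rewrite addrC [X in _ * X]mulrC -(race_first _ _ _ _ m0 l0 P2E P1E)//.
apply: eq_integral => y _ /=; congr (P1 _).
by apply/seteqP; split => x; rewrite /xsection /ysection /= !inE /A /=; case.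
Qed.
End race.

Set Implicit Arguments.
Unset Strict Implicit.

(** * Generated sigma-algebras and the epochs of a Poisson process *)

Section sigma_aux.
Context (T : Type) (G : set (set T)).

Lemma sigma_setC A : <<s G >> A -> <<s G >> (~` A).
Proof. by rewrite -setTD; exact: sigma_algebraCD. Qed.

Lemma sigma_setT : <<s G >> setT.
Proof. by have := sigma_setC (@sigma_algebra0 _ setT G); rewrite setC0. Qed.

Lemma sigma_bigcup (I : countType) (D : set I) (F : I -> set T) :
  (forall i, D i -> <<s G >> (F i)) -> <<s G >> (\bigcup_(i in D) F i).
Proof.
move=> mF; pose F' n := if unpickle n is Some i then
  (if `[< D i >] then F i else set0) else set0.
rewrite (_ : \bigcup_(i in D) F i = \bigcup_n F' n).
  apply: sigma_algebra_bigcup => n; rewrite /F'.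
  case: unpickle => [i|]; last exact: sigma_algebra0.
  by case: asboolP => [/mF//|_]; exact: sigma_algebra0.
apply/seteqP; split => w.
  move=> [i Di Fi]; exists (pickle i) => //.
  by rewrite /F' pickleK; case: asboolP.
by move=> [n _]; rewrite /F'; case: unpickle => // i; case: asboolP => // Di ?; exists i.
Qed.

Lemma sigma_setU A B : <<s G >> A -> <<s G >> B -> <<s G >> (A `|` B).
Proof.
move=> mA mB; rewrite (_ : _ `|` _ = \bigcup_(b in [set: bool]) if b then A else B).
  by apply: sigma_bigcup => -[].
apply/seteqP; split => w; first by case=> ?; [exists true|exists false].
by case=> -[] _ ?; [left|right].
Qed.

Lemma sigma_setI A B : <<s G >> A -> <<s G >> B -> <<s G >> (A `&` B).
Proof.
by move=> mA mB; rewrite -(setCK (A `&` B)) setCI; apply: sigma_setC;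
  apply: sigma_setU; exact: sigma_setC.
Qed.
End sigma_aux.

Section measure_aux.
Context d (T : measurableType d) (R : realType) (P : probability T R).

Lemma ae_eq_measure (A B : set T) : measurable A -> measurable B ->
  {ae P, forall w, A w <-> B w} -> P A = P B.
Proof.
move=> mA mB [N [mN N0 AB]].
have h (C D : set T) : measurable C -> measurable D ->
    C `<=` D `|` N -> (P C <= P D)%E.
  move=> mC mD CD; apply: (@le_trans _ _ (P (D `|` N))).
    by apply: le_measure; rewrite ?inE//; exact: measurableU.
  by rewrite (le_trans (measureU2 _ _ _))// [X in (_ + X)%E]N0 adde0.
apply/eqP; rewrite eq_le; apply/andP; split; apply: h => // w Cw;
  (have [Dw|nDw] := pselect (N w); first by right); left;
  have /contrapT [ab ba] := (fun h => nDw (AB w h)); first exact: ab.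
exact: ba.
Qed.

(** Both sides are finite measures of [A] that agree on a pi-system. *)
Lemma indep_sigma (G : set (set T)) (F : set T) :
  G `<=` measurable -> setI_closed G -> G setT -> measurable F ->
  (forall A, G A -> P (A `&` F) = (P A * P F)%E) ->
  forall A, <<s G >> A -> P (A `&` F) = (P A * P F)%E.
Proof.
move=> Gm GI GT mF GF A GA.
have PF0 : 0 <= fine (P F) by rewrite fine_ge0.
have PFE : ((fine (P F))%:E = P F)%E by rewrite fineK// fin_num_measure.
have H : (P (A `&` F) = (fine (P F))%:E * P A)%E.
  apply: (@g_sigma_algebra_measure_unique _ R T G Gm (fun=> setT) (fun=> GT) _
    (mrestr P mF) (mscale (NngNum PF0) P) GI) => //.
  - by rewrite bigcup_const//; exists 0%N.
  - move=> B GB; transitivity (P B * P F)%E; first exact: GF.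
    by transitivity ((fine (P F))%:E * P B)%E; [rewrite PFE muleC|].
  - move=> _; have : (P (setT `&` F) < +oo)%E; last by [].
    by rewrite setTI -ge0_fin_numE// fin_num_measure.
by rewrite H PFE muleC.
Qed.

Lemma measurable_fun_gt (G : set (set T)) (f : T -> R) :
  (forall x, <<s G >> [set w | x < f w]) ->
  forall B : set R, measurable B -> <<s G >> (f @^-1` B).
Proof.
move=> h B mB.
have mf : measurable_fun setT (f : g_sigma_algebraType G -> R).
  apply: (measurability _ (RGenOInfty.measurableE R)) => _ [_ [x ->]] <-.
  rewrite setTI; have := h x; congr (_ _); apply/seteqP; split => w /=; rewrite in_itv/= andbT//.
by have := mf measurableT B mB; rewrite setTI.
Qed.

End measure_aux.

(** Initial segments of indices suffice to state independence and common law, as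
    any [B i] may be the whole line. *)
Definition product_law d (T : measurableType d) (R : realType)
    (P : probability T R) (l : R) (U : nat -> T -> R) :=
  forall n (B : nat -> set R), (forall i, measurable (B i)) ->
    P (\bigcap_(i in `I_n) (U i @^-1` B i)) = (\prod_(i < n) exponential_prob l (B i))%E.

Section poisson.
Context d (T : measurableType d) (R : realType) (P : probability T R).
Variables (l : R) (N : T -> R -> nat).
Hypotheses (l0 : 0 < l) (pN : poisson_process P l N).

(** Cutting the partial sums off at 0 makes them nonnegative and monotone on
    every outcome, where the exponential variables only give this almost surely.
    The epochs are measurable with respect to the process itself, because epoch [k]
    comes after [x] exactly when fewer than [k] events are counted at [x]; this is
    how independence of the processes passes to the epochs. *)
Lemma poisson_epochs : exists S : nat -> T -> R,
  [/\ forall w, S 0%N w = 0,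
      forall k w, S k w <= S k.+1 w,
      forall w t k, 0 <= t -> (k <= N w t)%N <-> S k w <= t,
      forall k (B : set R), measurable B ->
        generated_by [set t | 0 <= t] N (S k @^-1` B) &
      (forall k, measurable_fun setT (S k)) /\ product_law P l (fun k w => S k.+1 w - S k w)].
Proof.
have [X [indX lawX NX]] := pN.
pose S k w := Num.max 0 (\sum_(i < k) X i w).
have NS w t k : 0 <= t -> (k <= N w t)%N <-> S k w <= t.
  by move=> t0; rewrite NX// /S ge_max t0.
have S0 w k : 0 <= S k w by rewrite /S le_max lexx.
have Snd k w : S k w <= S k.+1 w.
  by apply/NS => //; apply: ltnW; apply/NS.
have mS k : measurable_fun setT (S k).
  apply: measurable_maxr; first exact: measurable_cst.
  exact: measurable_sum.
exists S; split => //.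
- by move=> w; rewrite /S big_ord0 maxxx.
- move=> k; apply: measurable_fun_gt => x.
  have [x0|x0] := leP 0 x; last first.
    rewrite (_ : [set w | x < S k w] = setT); first exact: sigma_setT.
    by apply/seteqP; split => w //= _; apply: lt_le_trans x0 _.
  rewrite (_ : [set w | x < S k w] = \bigcup_(v in `I_k) [set w | N w x = v]).
    apply: sigma_bigcup => v _.
    by apply: sub_sigma_algebra; exists x, v.
  apply/seteqP; split => w /=.
    move=> xS; exists (N w x) => //=; rewrite ltnNge; apply/negP => /(NS w x k x0).
    by rewrite leNgt xS.
  by move=> [v /= vk Nv]; rewrite ltNge; apply/negP => /(NS w x k x0); rewrite Nv leqNgt vk.
split => // n B mB.
have posX : {ae P, forall w, forall i, 0 < X i w}.
  apply: ae_foralln => i.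
  have mXi : measurable (X i @^-1` `]0, +oo[%classic).
    by rewrite -[X in measurable X]setTI; apply: measurable_funP => //; exact: measurable_itv.
  exists (~` (X i @^-1` `]0, +oo[%classic)); split.
  - exact: measurableC.
  - change (P (~` (X i @^-1` `]0, +oo[%classic)) = 0%E); rewrite probability_setC//.
    have -> : P (X i @^-1` `]0, +oo[%classic) = exponential_prob l `]0, +oo[%classic.
      by rewrite -(lawX i)//; exact: measurable_itv.
    by rewrite exponential_prob_gt// mulr0 oppr0 expR0 subee.
  - by move=> w /= Xw; rewrite in_itv /= andbT.
have mU i : measurable_fun setT (fun w => S i.+1 w - S i w) by exact: measurable_funB.
pose J : {fset nat} := [fset i | i in iota 0 n]%fset.
have JE i : (i \in J) = (i < n)%N.
  apply/imfsetP/idP => /= [[k]|]; first by rewrite mem_iota => /andP[_ ?] ->.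
  by move=> ?; exists i => //; rewrite mem_iota.
transitivity (P (\bigcap_(i in [set` J]) (X i @^-1` B i))).
  apply: ae_eq_measure.
  - apply: bigcap_measurableType => i _.
    by rewrite -[X in measurable X]setTI; exact: mU.
  - apply: bigcap_measurableType => i _.
    by rewrite -[X in measurable X]setTI; exact: measurable_funP.
  apply: filterS posX => w Xpos.
  have SE k : S k w = \sum_(i < k) X i w.
    rewrite /S; apply/max_idPr; apply: sumr_ge0 => i _; exact: ltW.
  have UE k : S k.+1 w - S k w = X k w by rewrite !SE big_ord_recr /= [_ + X k w]addrC addrK.
  split => h i /=.
    by rewrite JE => ik; rewrite -UE; exact: h.
  by move=> ik; rewrite UE; apply: h => /=; rewrite JE.
rewrite indX// (perm_big (index_iota 0 n)) /=; last first.
  apply: uniq_perm; [exact: fset_uniq|exact: iota_uniq|].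
  by move=> i; rewrite JE mem_index_iota.
rewrite big_mkord; apply: eq_bigr => i _.
by rewrite -(lawX i).
Qed.

End poisson.

(** * The order of the events of two Poisson processes *)

Section merge.
Context d (T : measurableType d) (R : realType) (P : probability T R).
Variables (l m : R) (N1 N2 : T -> R -> nat) (S V : nat -> T -> R).
Hypotheses (l0 : 0 < l) (m0 : 0 < m).
Hypothesis indN : independent_processes P N1 N2.
Hypotheses (S00 : forall w, S 0%N w = 0) (V00 : forall w, V 0%N w = 0).
Hypotheses (Sgen : forall k (B : set R), measurable B ->
   generated_by [set t | 0 <= t] N1 (S k @^-1` B)).
Hypotheses (Vgen : forall k (B : set R), measurable B ->
   generated_by [set t | 0 <= t] N2 (V k @^-1` B)).
Hypotheses (mS : forall k, measurable_fun setT (S k)).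
Hypotheses (mV : forall k, measurable_fun setT (V k)).
Let U k w := S k.+1 w - S k w.
Let Y k w := V k.+1 w - V k w.
Hypotheses (lawU : product_law P l U) (lawY : product_law P m Y).

Let mU k : measurable_fun setT (U k). Proof. exact: measurable_funB. Qed.
Let mY k : measurable_fun setT (Y k). Proof. exact: measurable_funB. Qed.

Lemma gen_increment (N : T -> R -> nat) (f g : T -> R) :
  (forall B : set R, measurable B -> generated_by [set t | 0 <= t] N (f @^-1` B)) ->
  (forall B : set R, measurable B -> generated_by [set t | 0 <= t] N (g @^-1` B)) ->
  forall B : set R, measurable B -> generated_by [set t | 0 <= t] N ((f \- g) @^-1` B).
Proof.
rewrite /generated_by; set G := [set _ | _]; move=> hf hg B mB.
have mf : measurable_fun setT (f : g_sigma_algebraType G -> R).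
  by move=> _ C mC; rewrite setTI; exact: hf.
have mg : measurable_fun setT (g : g_sigma_algebraType G -> R).
  by move=> _ C mC; rewrite setTI; exact: hg.
by have := measurable_funB mf mg measurableT mB; rewrite setTI.
Qed.

Let Ugen k B := gen_increment (@Sgen k.+1) (@Sgen k) (B := B).
Let Ygen k B := gen_increment (@Vgen k.+1) (@Vgen k) (B := B).

Definition cylinder (X : nat -> T -> R) n (B : nat -> set R) : set T :=
  \bigcap_(k in `I_n) (X k @^-1` B k).

(** The events that generate the knowledge of the first [i] gaps of one process
    and the first [j] of the other: a pi-system. *)
Definition past i j : set (set T) :=
  [set A | exists B C, [/\ forall k, measurable (B k : set R),
     forall k, measurable (C k : set R) &
     A = cylinder U i B `&` cylinder Y j C]].

Lemma cylinder_gen (N : T -> R -> nat) (X : nat -> T -> R) n B :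
  (forall k, measurable (B k : set R)) ->
  (forall k (B : set R), measurable B -> generated_by [set t | 0 <= t] N (X k @^-1` B)) ->
  generated_by [set t | 0 <= t] N (cylinder X n B).
Proof.
move=> mB hX; rewrite -(setCK (cylinder X n B)) setC_bigcap.
by apply: sigma_setC; apply: sigma_bigcup => k _; apply: sigma_setC; exact: hX.
Qed.

Lemma cylinder_last (k : R) (X : nat -> T -> R) n B (C : set R) : product_law P k X ->
  (forall k, measurable (B k : set R)) -> measurable C ->
  P (cylinder X n B `&` X n @^-1` C) = (P (cylinder X n B) * exponential_prob k C)%E.
Proof.
move=> lawX mB mC.
pose B' i := if (i < n)%N then B i else C.
rewrite {2}/cylinder lawX//.
have -> : cylinder X n B `&` X n @^-1` C = cylinder X n.+1 B'.
  apply/seteqP; split => w.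
    move=> [h Cn] i /= ; rewrite ltnS leq_eqVlt /B' => /orP[/eqP->|ik].
      by rewrite ltnn.
    by rewrite ik; exact: h.
  move=> h; split.
    by move=> i /= ik; have := h i (ltnW ik : `I_n.+1 i); rewrite /B' ik.
  by have := h n (ltnSn n); rewrite /B' ltnn.
rewrite /cylinder lawX; last by move=> i; rewrite /B'; case: ifP.
rewrite big_ord_recr /= {2}/B' ltnn; congr (_ * _)%E.
by apply: eq_bigr => i _; rewrite /B' ltn_ord.
Qed.

Lemma past_setI i j : setI_closed (past i j).
Proof.
move=> _ _ [B [C [mB mC ->]]] [B' [C' [mB' mC' ->]]].
exists (fun k => B k `&` B' k), (fun k => C k `&` C' k); split.
- by move=> k; exact: measurableI.
- by move=> k; exact: measurableI.
- rewrite setIACA; congr (_ `&` _); apply/seteqP; split => w.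
  + by move=> [h h'] k kn /=; split; [exact: h|exact: h'].
  + by move=> h; split => k kn; have [] := h k kn.
  + by move=> [h h'] k kn /=; split; [exact: h|exact: h'].
  + by move=> h; split => k kn; have [] := h k kn.
Qed.

Lemma past_setT i j : past i j setT.
Proof.
exists (fun=> setT), (fun=> setT); split => //.
by apply/seteqP; split.
Qed.

Lemma measurable_cylinder (X : nat -> T -> R) n B : (forall k, measurable_fun setT (X k)) ->
  (forall k, measurable (B k : set R)) -> measurable (cylinder X n B).
Proof.
by move=> mX mB; apply: bigcap_measurableType => k _; rewrite -[X in measurable X]setTI; exact: mX.
Qed.

Lemma past_measurable i j : past i j `<=` measurable.
Proof. by move=> _ [B [C [mB mC ->]]]; apply: measurableI; exact: measurable_cylinder. Qed.

Lemma past_event_measurable i j A : <<s past i j >> A -> measurable A.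
Proof.
by apply: (smallest_sub _ (@past_measurable i j)); exact: sigma_algebra_measurable.
Qed.

Let mpre (f : T -> R) (B : set R) : measurable_fun setT f -> measurable B -> measurable (f @^-1` B).
Proof. by move=> mf mB; rewrite -[X in measurable X]setTI; exact: mf. Qed.

(** Independence of the two processes separates the gaps of different processes,
    and the product law those of the same process. *)
Lemma past_indep_rect i j K (C D : set R) : <<s past i j >> K -> measurable C -> measurable D ->
  P (K `&` (U i @^-1` C `&` Y j @^-1` D)) =
  (P K * (exponential_prob l C * exponential_prob m D))%E.
Proof.
move=> pK mC mD.
have mUC := mpre (mU i) mC. have mYD := mpre (mY j) mD.
have rect A B : generated_by [set t | 0 <= t] N1 A -> generated_by [set t | 0 <= t] N2 B ->
   P (A `&` B) = (P A * P B)%E by exact: indN.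
have key B B' : (forall k, measurable (B k : set R)) -> (forall k, measurable (B' k : set R)) ->
   P ((cylinder U i B `&` cylinder Y j B') `&` (U i @^-1` C `&` Y j @^-1` D)) =
   (P (cylinder U i B `&` cylinder Y j B') * (exponential_prob l C * exponential_prob m D))%E.
  move=> mB mB'; rewrite setIACA.
  have gB := cylinder_gen i mB Ugen; have gB' := cylinder_gen j mB' Ygen.
  rewrite (rect _ _ (sigma_setI gB (Ugen i mC)) (sigma_setI gB' (Ygen j mD))).
  rewrite (rect _ _ gB gB').
  rewrite (cylinder_last i lawU mB mC) (cylinder_last j lawY mB' mD).
  by rewrite muleACA.
have PF : P (U i @^-1` C `&` Y j @^-1` D) = (exponential_prob l C * exponential_prob m D)%E.
  have := key (fun=> setT) (fun=> setT) (fun=> measurableT) (fun=> measurableT).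
  have cT X n : cylinder X n (fun=> setT) = setT by apply/seteqP; split.
  by rewrite !cT !setTI probability_setT mul1e.
rewrite -PF; apply: (indep_sigma (@past_measurable i j) (@past_setI i j) (@past_setT i j)) => //.
  exact: measurableI.
by move=> A [B [B' [mB mB' ->]]]; rewrite PF key.
Qed.

Let RV0 (f : T -> R) (mf : measurable_fun setT f) : {RV P >-> R} :=
  HB.pack f (isMeasurableFun.Build _ _ _ _ f mf).
Let E1 : probability R R := distribution P (RV0 (mU 0)).
Let E2 : probability R R := distribution P (RV0 (mY 0)).

Let exp_marginal (k : R) (X : nat -> T -> R) n (C : set R) : product_law P k X ->
  measurable C -> P (X n @^-1` C) = exponential_prob k C.
Proof.
move=> lawX mC.
have := @cylinder_last k X n (fun=> setT) C lawX (fun=> measurableT) mC.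
have -> : cylinder X n (fun=> setT) = setT by apply/seteqP; split.
by rewrite setTI probability_setT mul1e.
Qed.

Lemma E1E B : measurable B -> E1 B = exponential_prob l B.
Proof. by move=> mB; exact: (exp_marginal 0 lawU). Qed.

Lemma E2E B : measurable B -> E2 B = exponential_prob m B.
Proof. by move=> mB; exact: (exp_marginal 0 lawY). Qed.

Let UY i j w := (U i w, Y j w).
Let mUY i j : measurable_fun setT (UY i j).
Proof. exact: measurable_fun_pair. Qed.

Let UYrv i j : {RV P >-> (R * R)%type} :=
  HB.pack (UY i j) (isMeasurableFun.Build _ _ _ _ (UY i j) (mUY i j)).

Lemma UY_law i j B : measurable B -> distribution P (UYrv i j) B = (E1 \x E2)%E B.
Proof.
move=> mB; apply/esym; apply: product_measure_unique => // C D mC mD.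
have := past_indep_rect (@sigma_setT _ (past i j)) mC mD.
by rewrite probability_setT mul1e setTI -E1E// -E2E.
Qed.

Lemma past_indep i j K B : <<s past i j >> K -> measurable B ->
  P (K `&` UY i j @^-1` B) = (P K * distribution P (UYrv i j) B)%E.
Proof.
move=> pK mB.
have mK : measurable K := past_event_measurable pK.
have rect C D : measurable C -> measurable D ->
    P (UY i j @^-1` (C `*` D)) = (exponential_prob l C * exponential_prob m D)%E.
  move=> mC mD.
  by have := past_indep_rect (@sigma_setT _ (past i j)) mC mD; rewrite probability_setT mul1e setTI.
pose G : set (set T) := [set A | exists C D, [/\ measurable (C : set R), measurable (D : set R) &
  A = UY i j @^-1` (C `*` D)]].
rewrite setIC muleC; apply: (@indep_sigma _ _ _ P G) => //.
- by move=> _ [C [D [mC mD ->]]]; rewrite -[X in measurable X]setTI; apply: mUY => //; exact: measurableX.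
- move=> _ _ [C [D [mC mD ->]]] [C' [D' [mC' mD' ->]]].
  exists (C `&` C'), (D `&` D'); split; [exact: measurableI|exact: measurableI|].
  by apply/seteqP; split=> w /=; [move=> [[? ?] [? ?]]|move=> [[? ?] [? ?]]].
- by exists setT, setT; split => //; apply/seteqP; split.
- by move=> _ [C [D [mC mD ->]]]; rewrite rect// setIC past_indep_rect// muleC.
- have mUY' : measurable_fun setT (UY i j : g_sigma_algebraType G -> R * R).
    apply: measurable_fun_pair => _ C mC; rewrite setTI; apply: sub_sigma_algebra.
      by exists C, setT; split => //; apply/seteqP; split => w //= [].
    by exists setT, C; split => //; apply/seteqP; split => w //= [].
  by have := mUY' measurableT _ mB; rewrite setTI.
Qed.

(** Given the past, the two next gaps are a fresh pair of exponential variables.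
    An event about them and a past quantity [D] is therefore compared with another
    one section by section, at each fixed value of [D]. *)
Lemma past_step i j K (D : T -> R) B1 B2 (c : R) : 0 <= c ->
  <<s past i j >> K -> (forall C : set R, measurable C -> <<s past i j >> (D @^-1` C)) ->
  measurable B1 -> measurable B2 ->
  (forall x, (E1 \x E2)%E (xsection B2 x) = (c%:E * (E1 \x E2) (xsection B1 x))%E) ->
  P (K `&` (fun w => (D w, UY i j w)) @^-1` B2) =
  (c%:E * P (K `&` (fun w => (D w, UY i j w)) @^-1` B1))%E.
Proof.
move=> c0 pK pD mB1 mB2 B12.
have pm := @past_event_measurable i j.
have mD : measurable_fun setT D by move=> _ C mC; rewrite setTI; exact: (pm _ (pD _ mC)).
pose k w := `[< K w >].
have kE : k @^-1` [set true] = K.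
  by apply/seteqP; split => w /= => [h|h]; [exact: (asboolW h)|exact: (asboolT h)].
pose Z w := (k w, D w).
have pZ (A : set (bool * R)) : measurable A -> <<s past i j >> (Z @^-1` A).
  move=> mA.
  have mZ : measurable_fun setT (Z : g_sigma_algebraType (past i j) -> bool * R).
    apply: measurable_fun_pair.
      by apply: (measurable_fun_bool true); rewrite setTI kE.
    by move=> _ C mC; rewrite setTI; exact: pD.
  by have := mZ measurableT _ mA; rewrite setTI.
have mZ : measurable_fun setT Z.
  by move=> _ A mA; rewrite setTI; exact: (pm _ (pZ _ mA)).
pose W w := (Z w, UY i j w).
have mW : measurable_fun setT W by exact: measurable_fun_pair.
pose Zrv : {RV P >-> (bool * R)%type} :=
  HB.pack Z (isMeasurableFun.Build _ _ _ _ Z mZ).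
pose Wrv : {RV P >-> ((bool * R) * (R * R))%type} :=
  HB.pack W (isMeasurableFun.Build _ _ _ _ W mW).
have rect A B : measurable A -> measurable B ->
    distribution P Wrv (A `*` B) = (distribution P Zrv A * distribution P (UYrv i j) B)%E.
  by move=> mA mB; rewrite -(past_indep (pZ _ mA) mB).
pose L (B : set (R * (R * R))) : set ((bool * R) * (R * R)) :=
  [set z | z.1.1 = true /\ B (z.1.2, z.2)].
have mL B : measurable B -> measurable (L B).
  move=> mB; rewrite (_ : L B = (fun z => z.1.1) @^-1` [set true] `&` (fun z => (z.1.2, z.2)) @^-1` B); last first.
    by apply/seteqP; split.
  apply: measurableI; rewrite -[X in measurable X]setTI.
    have h : measurable_fun setT (fun z : (bool * R) * (R * R) => z.1.1).
      exact: measurableT_comp.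
    exact: h.
  have h : measurable_fun setT (fun z : (bool * R) * (R * R) => (z.1.2, z.2)).
    by apply: measurable_fun_pair => //; exact: measurableT_comp.
  exact: h.
have PE B : measurable B -> P (K `&` (fun w => (D w, UY i j w)) @^-1` B) =
   (\int[distribution P Zrv]_z distribution P (UYrv i j) (xsection (L B) z))%E.
  move=> mB.
  have e := @product_measure_unique _ _ _ _ _ (distribution P Zrv) (distribution P (UYrv i j)) (distribution P Wrv) rect _ (mL _ mB).
  transitivity (distribution P Wrv (L B)); last by rewrite -e.
  rewrite /distribution /pushforward; congr (P _).
  apply/seteqP; split => w; rewrite /L /= /k.
    by move=> [kw Bw]; split => //; exact: asboolT.
  by move=> [kw Bw]; split => //; exact: asboolW.
rewrite !PE//.
rewrite -ge0_integralZl//.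
- apply: eq_integral => -[b x] _ /=.
  have xs B : xsection (L B) (b, x) = if b then xsection B x else set0.
    by case: b; apply/seteqP; split => y; rewrite /xsection /L /= ?inE //= => -[].
  rewrite !xs; case: (b); last by rewrite !measure0 mule0.
  by rewrite !UY_law//; exact: measurable_xsection.
- by have := measurable_fun_xsection (distribution P (UYrv i j)) (mL _ mB1).
Qed.

Lemma increments_pos : {ae P, forall w, forall k, S k w < S k.+1 w /\ V k w < V k.+1 w}.
Proof.
have pos (k : R) (X : nat -> T -> R) : 0 < k -> product_law P k X ->
    (forall n, measurable_fun setT (X n)) -> {ae P, forall w, forall n, 0 < X n w}.
  move=> k0 lawX mX; apply: ae_foralln => n.
  have mXn : measurable (X n @^-1` `]0, +oo[%classic).
    by rewrite -[X in measurable X]setTI; apply: mX => //; exact: measurable_itv.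
  exists (~` (X n @^-1` `]0, +oo[%classic)); split.
  - exact: measurableC.
  - change (P (~` (X n @^-1` `]0, +oo[%classic)) = 0%E); rewrite probability_setC//.
    rewrite (exp_marginal n lawX); last exact: measurable_itv.
    by rewrite exponential_prob_gt// mulr0 oppr0 expR0 subee.
  - by move=> w /= Xw; rewrite in_itv /= andbT.
have hU := pos _ _ l0 lawU mU; have hY := pos _ _ m0 lawY mY.
apply: filterS2 hU hY => w hu hy k; rewrite -(subr_gt0 (S k w)) -(subr_gt0 (V k w)).
by split; [exact: hu|exact: hy].
Qed.

(** Lists of bits are histories here: the most recent event comes first, and
    [true] is an event of the first process.  Each clause places an event after the
    last listed event of the other process; the order within a process is that of
    its epochs.  [merge_history] adds that the listed events precede both pending
    ones. *)
Fixpoint merge_past (h : seq bool) : set T :=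
  if h is b :: h' then merge_past h' `&`
    (if b then [set w | V (count negb h') w < S (count id h').+1 w]
     else [set w | S (count id h') w < V (count negb h').+1 w])
  else setT.

Definition merge_history (h : seq bool) : set T :=
  [set w | [/\ merge_past h w,
     Num.max (S (count id h) w) (V (count negb h) w) < S (count id h).+1 w &
     Num.max (S (count id h) w) (V (count negb h) w) < V (count negb h).+1 w]].

Lemma past_S i j k : (k <= i)%N ->
  measurable_fun setT (S k : g_sigma_algebraType (past i j) -> R).
Proof.
elim: k => [_|k IH ki].
  by rewrite (_ : S 0%N = cst 0); [exact: measurable_cst|apply/funext => w; rewrite S00].
rewrite (_ : S k.+1 = (S k \+ U k)); last by apply/funext => w; rewrite /U /= addrC subrK.
apply: measurable_funD; first exact: IH (ltnW ki).
move=> _ C mC; rewrite setTI; apply: sub_sigma_algebra.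
exists (fun n => if n == k then C else setT), (fun=> setT); split => //.
  by move=> n; case: ifP.
apply/seteqP; split => w.
  move=> Cw; split => // n /= ni; case: eqP => [->//|//].
by move=> [h _]; have := h k ki; rewrite /= eqxx.
Qed.

Lemma past_V i j k : (k <= j)%N ->
  measurable_fun setT (V k : g_sigma_algebraType (past i j) -> R).
Proof.
elim: k => [_|k IH ki].
  by rewrite (_ : V 0%N = cst 0); [exact: measurable_cst|apply/funext => w; rewrite V00].
rewrite (_ : V k.+1 = (V k \+ Y k)); last by apply/funext => w; rewrite /Y /= addrC subrK.
apply: measurable_funD; first exact: IH (ltnW ki).
move=> _ C mC; rewrite setTI; apply: sub_sigma_algebra.
exists (fun=> setT), (fun n => if n == k then C else setT); split => //.
  by move=> n; case: ifP.
apply/seteqP; split => w.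
  move=> Cw; split => // n /= ni; case: eqP => [->//|//].
by move=> [_ h]; have := h k ki; rewrite /= eqxx.
Qed.

Lemma merge_pastP h i j : (count id h <= i)%N -> (count negb h <= j)%N ->
  <<s past i j >> (merge_past h).
Proof.
elim: h => [_ _|b h IH]; first exact: sigma_setT.
case: b => /=; rewrite ?add1n ?add0n => ci cj; apply: sigma_setI; try by apply: IH => //; exact: ltnW.
- have := @measurable_lt_set _ (g_sigma_algebraType (past i j)) R _ _ (@past_V i j _ cj) (@past_S i j _ ci).
  by [].
- have := @measurable_lt_set _ (g_sigma_algebraType (past i j)) R _ _ (@past_S i j _ ci) (@past_V i j _ cj).
  by [].
Qed.

Definition step_prob (b : bool) : R := if b then l / (l + m) else m / (l + m).

Lemma measurable_merge_history h : measurable (merge_history h).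
Proof.
have -> : merge_history h = merge_past h `&`
   [set w | Num.max (S (count id h) w) (V (count negb h) w) < S (count id h).+1 w] `&`
   [set w | Num.max (S (count id h) w) (V (count negb h) w) < V (count negb h).+1 w].
  by apply/seteqP; split => w; [case|case=> -[]].
have mmax i j : measurable_fun setT (fun w => Num.max (S i w) (V j w)).
  exact: measurable_maxr.
apply: measurableI; last exact: measurable_lt_set.
apply: measurableI; last exact: measurable_lt_set.
by apply: (@past_event_measurable (count id h) (count negb h)); exact: merge_pastP.
Qed.

(** The memoryless step.  With [D] the last epoch of the second process minus that
    of the first, the positive part of [D] is the time that the first clock has
    been running at the latest event, and the positive part of [- D] is that of
    the second clock: one of them has just been reset.  A history says that both
    clocks have survived these times, and its extension says which one rings first,
    so the probabilities of [race_survive] and [race_first] have the ratio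
    [step_prob b]. *)
Lemma merge_history_cons b h :
  P (merge_history (b :: h)) = ((step_prob b)%:E * P (merge_history h))%E.
Proof.
set i := count id h; set j := count negb h.
pose D w := V j w - S i w.
have pD (C : set R) : measurable C -> <<s past i j >> (D @^-1` C).
  move=> mC; have := measurable_funB (@past_V i j _ (leqnn j)) (@past_S i j _ (leqnn i)) measurableT mC.
  by rewrite setTI.
have pm := @past_event_measurable i j.
have mD : measurable_fun setT D by move=> _ C mC; rewrite setTI; exact: (pm _ (pD _ mC)).
have pK : <<s past i j >> (merge_past h) by exact: merge_pastP.
pose a (x : R) := Num.max x 0.
have ma : measurable_fun setT a by apply: measurable_maxr => //; exact: measurable_cst.
have ma' : measurable_fun setT (fun x : R => a (- x)) by exact: measurableT_comp.
have a0 x : 0 <= a x by rewrite le_max lexx orbT.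
pose B1 : set (R * (R * R)) := [set z | a z.1 < z.2.1 /\ a (- z.1) < z.2.2].
pose B2 c : set (R * (R * R)) := [set z | [/\ a z.1 < z.2.1, a (- z.1) < z.2.2 &
   if c then z.2.1 - a z.1 < z.2.2 - a (- z.1) else z.2.2 - a (- z.1) < z.2.1 - a z.1]].
have mx : measurable_fun setT (fun z : R * (R * R) => z.2.1) by exact: measurableT_comp.
have my : measurable_fun setT (fun z : R * (R * R) => z.2.2) by exact: measurableT_comp.
have mz : measurable_fun setT (fun z : R * (R * R) => a z.1) by exact: measurableT_comp.
have mz' : measurable_fun setT (fun z : R * (R * R) => a (- z.1)).
  by apply: (measurableT_comp ma').
have mB1 : measurable B1.
  rewrite (_ : B1 = [set z | a z.1 < z.2.1] `&` [set z | a (- z.1) < z.2.2])//.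
  by apply: measurableI; exact: measurable_lt_set.
have mB2 c : measurable (B2 c).
  rewrite (_ : B2 c = B1 `&` [set z | if c then z.2.1 - a z.1 < z.2.2 - a (- z.1)
      else z.2.2 - a (- z.1) < z.2.1 - a z.1]); last first.
    by apply/seteqP; split => z; [case|case=> -[]].
  by apply: measurableI => //; case: c; apply: measurable_lt_set; exact: measurable_funB.
have max_i w : Num.max (S i w) (V j w) = S i w + a (D w).
  by rewrite /a /D addr_maxr addr0 addrC subrK maxC.
have max_j w : Num.max (S i w) (V j w) = V j w + a (- D w).
  by rewrite /a /D addr_maxr addr0 opprB addrC subrK.
have HE : merge_history h = merge_past h `&` (fun w => (D w, UY i j w)) @^-1` B1.
  apply/seteqP; split => w; rewrite /merge_history /= -/i -/j.
    by move=> [kw]; rewrite {1}max_i max_j /B1 /= /U /Y !ltrBrDl.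
  by move=> [kw]; rewrite /B1 /= /U /Y !ltrBrDl {1}max_i max_j => -[].
rewrite HE -(@past_step _ _ _ D B1 (B2 b))//; last 2 first.
- by case: (b); rewrite /step_prob divr_ge0// ?ltW// addr_gt0.
- move=> x; have -> : xsection B1 x = [set z | a x < z.1 /\ a (- x) < z.2].
    by apply/seteqP; split => z; rewrite /xsection /= inE.
  rewrite (race_survive _ _ _ _ l0 m0 E1E E2E)//.
  have -> : xsection (B2 b) x = [set z | [/\ a x < z.1, a (- x) < z.2 &
    if b then z.1 - a x < z.2 - a (- x) else z.2 - a (- x) < z.1 - a x]].
    by apply/seteqP; split => z; rewrite /xsection /= inE.
  case: (b); rewrite -EFinM /step_prob.
    by rewrite (race_first _ _ _ _ l0 m0 E1E E2E).
  by rewrite (race_second _ _ _ _ _ _ l0 m0 E1E E2E).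
apply: ae_eq_measure; first exact: measurable_merge_history.
  apply: measurableI; first exact: pm.
  rewrite -[X in measurable X]setTI.
  have h1 : measurable_fun setT (fun w => (D w, UY i j w)) by exact: measurable_fun_pair.
  exact: h1.
apply: filterS increments_pos => w pos.
have BE : ((fun w => (D w, UY i j w)) @^-1` B2 b) w <->
  [/\ Num.max (S i w) (V j w) < S i.+1 w, Num.max (S i w) (V j w) < V j.+1 w &
    if b then S i.+1 w < V j.+1 w else V j.+1 w < S i.+1 w].
  rewrite {1}max_i max_j /B2 /= /U /Y !ltrBrDl.
  have e : S i w + a (D w) = V j w + a (- D w) by rewrite -max_i max_j.
  by split => -[? ? c]; split => //; move: c; case: (b) => c; lra.
have [Si _] := pos i; have [_ Vj] := pos j.
have [Si' _] := pos i.+1; have [_ Vj'] := pos j.+1.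
have tr (P1 P2 Q : Prop) : (P1 <-> P2) -> (Q /\ P1 <-> Q /\ P2) by move=> [? ?]; split => -[]; auto.
apply: (@iff_trans _ (merge_past h w /\ [/\ Num.max (S i w) (V j w) < S i.+1 w,
  Num.max (S i w) (V j w) < V j.+1 w &
  if b then S i.+1 w < V j.+1 w else V j.+1 w < S i.+1 w])); last first.
  by split => -[kw h2]; split => //; apply/BE.
rewrite /merge_history /=; case: (b); rewrite ?add1n ?add0n -/i -/j !gt_max; split.
- move=> [[kw c1] /andP[c2 c3] /andP[c4 c5]]; split => //; split => //; rewrite ?Si ?Vj ?c1 ?c5 ?andbT//.
  exact: lt_trans c4.
- move=> [kw [/andP[c1 c2] /andP[c3 c4] c5]]; split; [by []|..]; rewrite ?Si' ?c5 ?c4 ?andbT//=.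
  exact: lt_trans Si'.
- move=> [[kw c1] /andP[c2 c3] /andP[c4 c5]]; split => //; split => //; rewrite ?Si ?Vj ?c1 ?c2 ?andbT//=.
  exact: lt_trans c3.
- move=> [kw [/andP[c1 c2] /andP[c3 c4] c5]]; split; [by []|..]; rewrite ?Vj' ?c5 ?c1 ?andbT//=.
  exact: lt_trans Vj'.
Qed.

Lemma merge_history_nil : P (merge_history [::]) = 1%E.
Proof.
rewrite -(probability_setT P); apply: ae_eq_measure => //; first exact: measurable_merge_history.
apply: filterS increments_pos => w pos; split => // _.
have [S1 V1] := pos 0%N; rewrite S00 in S1; rewrite V00 in V1.
by rewrite /merge_history /= S00 V00 maxxx.
Qed.

(** Two clocks almost surely never ring at the same time, since the two orders of
    the next event already exhaust the probability. *)
Lemma merge_history_total :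
  {ae P, forall w, forall n, exists2 h, size h = n & merge_history h w}.
Proof.
have next : {ae P, forall w, forall h, merge_history h w ->
    exists b, merge_history (b :: h) w}.
  suff H : {ae P, forall w, forall n h, unpickle n = Some h -> merge_history h w ->
      exists b, merge_history (b :: h) w}.
    by apply: filterS H => w H h; apply: (H (pickle h)); exact: pickleK.
  apply: ae_foralln => n; case: (unpickle n) => [h|]; last first.
    by apply: filterS (increments_pos).
  have mH := measurable_merge_history.
  pose A := merge_history h; pose B := merge_history (true :: h) `|` merge_history (false :: h).
  have mA : measurable A by exact: mH.
  have mB : measurable B by apply: measurableU; exact: mH.
  have PAB : P B = P A.
    transitivity (P (merge_history (true :: h)) + P (merge_history (false :: h)))%E.
      apply: measureU; [exact: mH|exact: mH|].
      apply/seteqP; split => w //; rewrite /merge_history /= add1n add0n !gt_max.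
      by move=> [[_ _ /andP[c1 _]] [_ /andP[_ c2] _]]; have := lt_trans c1 c2; rewrite ltxx.
    rewrite !merge_history_cons -ge0_muleDl ?lee_fin ?divr_ge0 ?ltW ?addr_gt0//.
    by rewrite -EFinD -mulrDl divff ?mul1e// gt_eqF// addr_gt0.
  have PI : P (A `&` B) = P A.
    rewrite -PAB; apply: ae_eq_measure => //; first exact: measurableI.
    apply: filterS increments_pos => w pos; split => [[]//|Bw]; split => //.
    have [Si _] := pos (count id h); have [_ Vj] := pos (count negb h).
    case: Bw; rewrite /merge_history /= add1n add0n !gt_max => -[[kw c0] /andP[c1 c2] /andP[c3 c4]].
      by split; rewrite // gt_max ?Si ?Vj ?c0 ?c4 ?andbT// (lt_trans Si c3).
    by split; rewrite // gt_max ?Si ?Vj ?c0 ?c1 ?andbT// (lt_trans Vj c2).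
  exists (A `\` B); split; first exact: measurableD.
    change (P (A `\` B) = 0%E).
    transitivity (P A - P (A `&` B))%E.
      by apply: measureD => //; rewrite -ge0_fin_numE// fin_num_measure.
    by rewrite PI subee// fin_num_measure.
  move=> w /= H; apply: contrapT => nAB; apply: H => h' [<-] hw.
  apply: contrapT => nb; apply: nAB; split=> // -[] Bw; apply: nb;
    by [exists true|exists false].
apply: filterS2 next increments_pos => w nw pos.
have h0 : merge_history [::] w.
  have [S1 V1] := pos 0%N; rewrite S00 in S1; rewrite V00 in V1.
  by split => //=; rewrite S00 V00 maxxx.
elim=> [|n [h hn hw]]; first by exists [::].
by have [b bw] := nw _ hw; exists (b :: h) => //=; rewrite hn.
Qed.

Lemma merge_history_prob h :
  P (merge_history h) = (\prod_(b <- h) step_prob b)%:E.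
Proof.
elim: h => [|b h IH]; first by rewrite merge_history_nil big_nil.
by rewrite merge_history_cons IH big_cons EFinM.
Qed.
End merge.

(** * The arrival bits of a sample path *)

Definition arrival_bit (R : realType) (x : sample_path R) (n : nat) : bool :=
  ((x (event_time x n)).1 < (x (event_time x n.+1)).1)%N.

Definition epochs (R : realType) (x : sample_path R) (s v : nat -> R) :=
  [/\ s 0%N = 0, v 0%N = 0, (forall k, s k <= s k.+1) /\ (forall k, v k <= v k.+1),
   forall t k, 0 <= t -> (k <= (x t).1)%N <-> s k <= t &
   forall t k, 0 <= t -> (k <= (x t).2)%N <-> v k <= t].

Section path_times.
Context (R : realType) (x : sample_path R) (s v : nat -> R).
Hypothesis xsv : epochs x s v.

Let s_ge0 k : 0 <= s k.
Proof. by case: xsv => s0 _ [sS _] _ _; elim: k => [|k IH]; [rewrite s0|exact: le_trans (sS k)]. Qed.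

Let x1_mono t u : 0 <= t -> t <= u -> ((x t).1 <= (x u).1)%N.
Proof.
case: xsv => _ _ _ sx _ t0 tu; apply/sx; first exact: le_trans tu.
by apply: le_trans tu; apply/sx.
Qed.

Let x2_mono t u : 0 <= t -> t <= u -> ((x t).2 <= (x u).2)%N.
Proof.
case: xsv => _ _ _ _ vx t0 tu; apply/vx; first exact: le_trans tu.
by apply: le_trans tu; apply/vx.
Qed.

Let reached n := [set t : R | 0 <= t /\ (n <= num_events x t)%N].

Let reached_sn n : reached n (s n).
Proof.
split; first exact: s_ge0.
by case: xsv => _ _ _ sx _; rewrite /num_events (leq_trans _ (leq_addr _ _))//; apply/sx.
Qed.

Let reached_lb n : has_lbound (reached n).
Proof. by exists 0 => t []. Qed.

Let event_time_ge0 n : 0 <= event_time x n.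
Proof. by apply: lb_le_inf => [|t []//]; exists (s n); exact: reached_sn. Qed.

(** The hypotheses exclude any further event up to the latest of the first [i]
    arrivals and [j] tokens. *)
Lemma event_time_merge i j :
  Num.max (s i) (v j) < s i.+1 -> Num.max (s i) (v j) < v j.+1 ->
  event_time x (i + j) = Num.max (s i) (v j) /\ (x (event_time x (i + j))).1 = i.
Proof.
case: xsv => s0 v0 [sS vS] sx vx; set M := Num.max _ _ => Ms Mv.
have M0 : 0 <= M by rewrite le_max s_ge0.
have xlt t k : 0 <= t -> t < s k -> ((x t).1 < k)%N.
  by move=> t0 tk; rewrite ltnNge; apply/negP => /(sx _ _ t0); rewrite leNgt tk.
have xlt2 t k : 0 <= t -> t < v k -> ((x t).2 < k)%N.
  by move=> t0 tk; rewrite ltnNge; apply/negP => /(vx _ _ t0); rewrite leNgt tk.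
have eM : event_time x (i + j) = M.
  apply/eqP; rewrite eq_le; apply/andP; split.
    apply: (ge_inf (@reached_lb _)); split => //; rewrite /num_events leq_add//.
      by apply/(sx _ _ M0); rewrite /M le_max lexx.
    by apply/(vx _ _ M0); rewrite /M le_max lexx orbT.
  apply: lb_le_inf; first by exists (s (i + j)%N); exact: reached_sn.
  move=> t [t0]; rewrite leNgt /num_events => tn; apply/negP => tM; move: tn.
  have := xlt t i.+1 t0 (lt_trans tM Ms); have := xlt2 t j.+1 t0 (lt_trans tM Mv).
  move: tM; rewrite lt_max => /orP[/(xlt _ _ t0)|/(xlt2 _ _ t0)]; lia.
split => //; rewrite eM; apply/eqP; rewrite eqn_leq; apply/andP; split.
  by rewrite -ltnS; exact: xlt.
by apply/(sx _ _ M0); rewrite /M le_max lexx.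
Qed.

(** By right continuity, the number of arrivals at an event time is less than [a]
    exactly when some rational time at or after the event still counts fewer.  This describes the bits by countably many values of the path. *)
Lemma arrivals_at_event n a : (a <= (x (event_time x n)).1)%N <->
  ~ exists q : rat, [/\ 0 <= ratr q :> R, (n <= num_events x (ratr q))%N & ((x (ratr q)).1 < a)%N].
Proof.
case: xsv => s0 v0 [sS vS] sx vx; split.
  move=> /(sx _ _ (event_time_ge0 n)) sa [q [q0 nq]]; rewrite ltnNge => /negP; apply.
  apply/sx => //; apply: le_trans sa _; exact: (ge_inf (@reached_lb n)).
move=> nq; apply/sx => //; apply: lb_le_inf; first by exists (s n); exact: reached_sn.
move=> t [t0 nt]; rewrite leNgt; apply/negP => ta; apply: nq.
have [q] := rat_in_itvoo ta; rewrite in_itv /= => /andP[tq qa].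
have q0 : 0 <= ratr q :> R by exact: le_trans (ltW tq).
exists q; split => //.
  by apply: leq_trans nt _; apply: leq_add; [apply: x1_mono|apply: x2_mono] => //; exact: ltW.
by rewrite ltnNge; apply/negP => /(sx _ _ q0); rewrite leNgt qa.
Qed.

End path_times.

Lemma sigma_arrival_bit (R : realType) (T : Type) (G : set (set T))
    (x : T -> sample_path R) n :
  (forall w, exists s v, epochs (x w) s v) ->
  (forall t c, 0 <= t -> <<s G >> [set w | x w t = c]) ->
  <<s G >> [set w | arrival_bit (x w) n].
Proof.
move=> xe xG.
have xG' t (C : set (nat * nat)) : 0 <= t -> <<s G >> [set w | C (x w t)].
  move=> t0; rewrite (_ : [set w | C (x w t)] = \bigcup_(c in C) [set w | x w t = c]).
    by apply: sigma_bigcup => c _; exact: xG.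
  by apply/seteqP; split => w /=; [move=> ?; exists (x w t)|move=> [c Cc ->]].
have atG k a : <<s G >> [set w | (a <= (x w (event_time (x w) k)).1)%N].
  rewrite (_ : [set w | _] = ~` \bigcup_(q in [set q : rat | 0 <= ratr q :> R])
    [set w | (k <= num_events (x w) (ratr q))%N && ((x w (ratr q)).1 < a)%N]).
    apply: sigma_setC; apply: sigma_bigcup => q /= q0.
    exact: (@xG' (ratr q) (fun c => (k <= c.1 + c.2)%N && (c.1 < a)%N)).
  apply/seteqP; split => w /=; have [s [v sv]] := xe w.
    move=> /(arrivals_at_event sv) h [q /= q0 /andP[kq qa]]; apply: h.
    by exists q; split.
  move=> h; apply/(arrivals_at_event sv) => -[q [q0 kq qa]]; apply: h.
  by exists q => //=; rewrite kq.
rewrite (_ : [set w | _] = \bigcup_a (~` [set w | (a <= (x w (event_time (x w) n)).1)%N] `&`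
   [set w | (a <= (x w (event_time (x w) n.+1)).1)%N])).
  by apply: sigma_bigcup => a _; apply: sigma_setI => //; exact: sigma_setC.
apply/seteqP; split => w /=; rewrite /arrival_bit.
  move=> h; exists (x w (event_time (x w) n.+1)).1 => //=; split => //.
  by apply/negP; rewrite -ltnNge.
by move=> [a _ [/negP]]; rewrite -ltnNge; exact: leq_trans.
Qed.

Definition coin_law (R : realType) (q : R) (s : seq bool) : R :=
  \prod_(c <- s) (if c then q else 1 - q).

(** Independent bits with success probability [q], given by the law of their
    prefixes. *)
Definition coin_flips d (T : measurableType d) (R : realType) (P : probability T R)
    (q : R) (b : T -> nat -> bool) :=
  (forall n, measurable [set w | b w n]) /\
  forall s, P [set w | mkseq (b w) (size s) = s] = (coin_law q s)%:E.

Lemma measurable_prefix d (T : measurableType d) (b : T -> nat -> bool) (s : seq bool) n :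
  (forall n, measurable [set w | b w n]) -> measurable [set w | mkseq (b w) n = s].
Proof.
move=> mb; elim: n s => [|n IH] s.
  by case: s => [|c s]; [rewrite (_ : [set w | _] = setT)|rewrite (_ : [set w | _] = set0)];
    rewrite //; apply/seteqP; split.
have mk w : mkseq (b w) n.+1 = rcons (mkseq (b w) n) (b w n) by exact: mkseqS.
case: (lastP s) => [|s' c].
  have -> : [set w | mkseq (b w) n.+1 = [::]] = set0 by apply/seteqP; split.
  exact: measurable0.
rewrite (_ : [set w | _] = [set w | mkseq (b w) n = s'] `&`
    (if c then [set w | b w n] else ~` [set w | b w n])).
  by apply: measurableI => //; case: c => //; exact: measurableC.
apply/seteqP; split => w h.
  have {h} : mkseq (b w) n.+1 = rcons s' c := h; rewrite mk.
  move/eqP; rewrite eqseq_rcons => /andP[/eqP e1 /eqP e2]; split; first exact: e1.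
  by rewrite -e2; case E: (b w n) => //=; rewrite E.
change (mkseq (b w) n.+1 = rcons s' c); rewrite mk; case: h => /= -> h.
by congr rcons; move: h; case: c => //= /negP/negbTE.
Qed.

Section queue_bits.
Context (R : realType) (p lam : R) (mdl : queue_model R).
Hypotheses (p01 : 0 < p < 1) (lam0 : 0 < lam).
Hypothesis Q : is_queue p lam mdl.
Notation P := (model_prob mdl).

Lemma queue_epochs w : exists s v, epochs (model_path mdl w) s v.
Proof.
have p0 : 0 < 1 - p by case/andP: p01 => _; rewrite subr_gt0.
case: Q => /(poisson_epochs lam0)[S [S0 SS SN _ _]] /(poisson_epochs p0)[V [V0 VS VN _ _]] _.
exists (S^~ w), (V^~ w); split; [exact: S0|exact: V0|by split=> k; [exact: SS|exact: VS]|..].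
  by move=> t k; exact: SN.
by move=> t k; exact: VN.
Qed.

Lemma measurable_model_path t c : 0 <= t -> measurable [set w | model_path mdl w t = c].
Proof.
move=> t0.
have p0 : 0 < 1 - p by case/andP: p01 => _; rewrite subr_gt0.
case: Q => /(poisson_epochs lam0)[S [_ _ SN _ [mS _]]] /(poisson_epochs p0)[V [_ _ VN _ [mV _]]] _.
have count_level (N : outcome mdl -> R -> nat) (f : nat -> outcome mdl -> R) k :
    (forall w t k, 0 <= t -> (k <= N w t)%N <-> f k w <= t) ->
    (forall k, measurable_fun setT (f k)) -> measurable [set w | N w t = k].
  move=> Nf mf; rewrite (_ : [set w | _] = (~` [set w | t < f k w]) `&` [set w | t < f k.+1 w]).
    apply: measurableI; first apply: measurableC.
      by apply: measurable_lt_set => //; exact: measurable_cst.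
    by apply: measurable_lt_set => //; exact: measurable_cst.
  apply/seteqP; split => w /=.
    move=> Nk; split.
      by apply/negP; rewrite -leNgt; apply/(Nf w t k t0); rewrite Nk.
    by rewrite ltNge; apply/negP => /(Nf w t _ t0); rewrite Nk ltnn.
  move=> [/negP]; rewrite -leNgt => /(Nf w t _ t0) h1 h2.
  apply/eqP; rewrite eqn_leq h1 andbT -ltnS ltnNge; apply/negP => /(Nf w t _ t0).
  by rewrite leNgt h2.
rewrite (_ : [set w | _] = [set w | (model_path mdl w t).1 = c.1] `&`
   [set w | (model_path mdl w t).2 = c.2]).
  apply: measurableI.
    exact: (count_level (fun w t => (model_path mdl w t).1) S c.1 SN mS).
  exact: (count_level (fun w t => (model_path mdl w t).2) V c.2 VN mV).
apply/seteqP; split => w /=; first by move=> ->.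
by case: (model_path mdl w t) => a b; case: c => a' b' /= [-> ->].
Qed.

(** Almost every outcome has a merge history of each length, and its events in
    the order of time are the first bits. *)
Lemma queue_coin_flips :
  coin_flips P (lam / (lam + (1 - p))) (fun w => arrival_bit (model_path mdl w)).
Proof.
have p0 : 0 < 1 - p by case/andP: p01 => _; rewrite subr_gt0.
have mb n : measurable [set w | arrival_bit (model_path mdl w) n].
  have := @sigma_arrival_bit R (outcome mdl) measurable (model_path mdl) n queue_epochs.
  rewrite sigma_algebra_id; last exact: sigma_algebra_measurable.
  by apply; exact: measurable_model_path.
split => // s.
case: Q => /(poisson_epochs lam0)[S [S0 SS SN Sgen [mS lawS]]].
move=> /(poisson_epochs p0)[V [V0 VS VN Vgen [mV lawV]]] ind.
have pr := merge_history_prob lam0 p0 ind S0 V0 Sgen Vgen mS mV lawS lawV (rev s).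
have tot := merge_history_total lam0 p0 ind S0 V0 Sgen Vgen mS mV lawS lawV.
have pos := increments_pos lam0 p0 mS mV lawS lawV.
transitivity (P (merge_history S V (rev s))); last first.
  rewrite pr /coin_law; congr (_%:E).
  rewrite (perm_big s) /=; last by rewrite perm_rev.
  apply: eq_bigr => -[] _ //=; rewrite /step_prob.
  by field; rewrite gt_eqF// addr_gt0.
apply: ae_eq_measure.
- exact: measurable_prefix.
- exact: measurable_merge_history.
apply: filterS2 tot pos => w totw posw.
have xw : epochs (model_path mdl w) (S^~ w) (V^~ w).
  split; [exact: S0|exact: V0|by split=> k; [exact: SS|exact: VS]|..].
    by move=> t k; exact: SN.
  by move=> t k; exact: VN.
have hist h : merge_history S V h w -> mkseq (arrival_bit (model_path mdl w)) (size h) = rev h.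
  elim: h => [//|b h IH] bh.
  have hh : merge_history S V h w.
    have [Si _] := posw (count id h); have [_ Vj] := posw (count negb h).
    move: bh; rewrite /merge_history; case: b => /=; rewrite ?add1n ?add0n !gt_max.
      move=> [[kw c0] /andP[c1 c2] /andP[c3 c4]].
      by split; [exact: kw|rewrite Si c0|rewrite c4 (lt_trans Si c3)].
    move=> [[kw c0] /andP[c1 c2] /andP[c3 c4]].
    by split; [exact: kw|rewrite c1 (lt_trans Vj c2)|rewrite c0 Vj].
  rewrite rev_cons /= mkseqS IH//; congr rcons.
  have sz g : size g = (count id g + count negb g)%N by rewrite -(count_predC id).
  case: (hh) => _ h1 h2; have [_ e1] := event_time_merge xw h1 h2.
  case: (bh) => _ b1 b2; have [_ e2] := event_time_merge xw b1 b2.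
  rewrite /arrival_bit -[(size h).+1]/(size (b :: h)) !sz e1 e2 /=.
  by case: (b); rewrite ?add1n ?ltnS ?leqnn ?add0n ?ltnn.
split.
  move=> /= es; have [h hs hw] := totw (size s).
  by have := hist h hw; rewrite hs es => ->; rewrite revK.
by move=> /hist /=; rewrite size_rev revK.
Qed.
End queue_bits.

(** * Moments of the backlog *)

(** [mean q n f] is the expectation of [f] over [n] independent bits, each equal
    to [true] with probability [q]. *)
Fixpoint mean (R : realType) (q : R) (n : nat) (f : seq bool -> R) : R :=
  if n is k.+1 then mean q k (fun s => q * f (true :: s) + (1 - q) * f (false :: s))
  else f [::].

(** The largest excess of tokens over arrivals among the prefixes of [s].  The
    recursion is that of a queue running backwards in time, in which a token joins
    and an arrival leaves. *)
Fixpoint backlog (s : seq bool) : nat :=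
  if s is b :: s' then (if b then (backlog s').-1 else (backlog s').+1) else 0%N.

Fixpoint total_backlog (s : seq bool) : nat :=
  if s is b :: s' then (backlog s' + total_backlog s')%N else 0%N.

Definition tokens (s : seq bool) : nat := count negb s.

Section mean_theory.
Context {R : realType}.
Implicit Types (q : R) (f g : seq bool -> R) (s : seq bool).

Lemma eq_mean q n f g : (forall s, size s = n -> f s = g s) -> mean q n f = mean q n g.
Proof.
elim: n f g => [|n IH] f g fg /=; first exact: fg.
by apply: IH => s sn; rewrite !fg//= sn.
Qed.

Lemma meanD q n f g : mean q n (fun s => f s + g s) = mean q n f + mean q n g.
Proof.
elim: n f g => [//|n IH] f g /=; rewrite -IH; apply: eq_mean => s _; ring.
Qed.

Lemma meanZ q n a f : mean q n (fun s => a * f s) = a * mean q n f.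
Proof.
elim: n f => [//|n IH] f /=; rewrite -IH; apply: eq_mean => s _; ring.
Qed.

Lemma mean_cst q n a : mean q n (fun=> a) = a.
Proof.
elim: n => [//|n IH] /=; rewrite -[RHS]IH; apply: eq_mean => s _; ring.
Qed.

Lemma mean_sum q n (I : Type) (r : seq I) (F : I -> seq bool -> R) :
  mean q n (fun s => \sum_(i <- r) F i s) = \sum_(i <- r) mean q n (F i).
Proof.
elim: r => [|i r IH].
  by rewrite big_nil -[RHS](mean_cst q n 0); apply: eq_mean => s _; rewrite big_nil.
by rewrite big_cons -IH -meanD; apply: eq_mean => s _; rewrite big_cons.
Qed.

Lemma ler_mean q n f g : 0 <= q <= 1 -> (forall s, size s = n -> f s <= g s) ->
  mean q n f <= mean q n g.
Proof.
move=> /andP[q0 q1]; elim: n f g => [|n IH] f g fg /=; first exact: fg.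
apply: IH => s sn; apply: lerD; apply: ler_wpM2l; rewrite ?subr_ge0//; apply: fg; by rewrite /= sn.
Qed.

Lemma mean_cons q n f :
  mean q n.+1 f = q * mean q n (fun s => f (true :: s)) + (1 - q) * mean q n (fun s => f (false :: s)).
Proof. by rewrite /= meanD !meanZ. Qed.

Lemma mean_cat q a b f :
  mean q (a + b) f = mean q a (fun s => mean q b (fun t => f (s ++ t))).
Proof.
elim: a f => [//|a IH] f; rewrite addSn /= IH; apply: eq_mean => s _.
by rewrite meanD !meanZ.
Qed.

Section moments.
Variable q : R.
Hypothesis q_half : 1 < 2 * q.
Hypothesis q1 : q <= 1.
Let del := 2 * q - 1.
Let del0 : 0 < del. Proof. by rewrite /del subr_gt0. Qed.
Let q01 : 0 <= q <= 1. Proof. by move: q_half q1 => h1 h2; apply/andP; split; lra. Qed.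
Notation z s := ((backlog s)%:R : R).

Lemma mean_tokens_sq n :
  mean q n (fun s => ((tokens s)%:R - (1 - q) * (size s)%:R) ^+ 2) = q * (1 - q) * n%:R.
Proof.
elim: n => [|n IH]; first by rewrite /= mulr0 subr0 expr0n /= mulr0.
rewrite -natr1 mulrDr -IH mulr1.
transitivity (mean q n (fun s => ((tokens s)%:R - (1 - q) * (size s)%:R) ^+ 2 + q * (1 - q))).
  rewrite [LHS]/=; apply: eq_mean => s _; rewrite /tokens /= add0n add1n -!natr1; ring.
by rewrite meanD mean_cst.
Qed.

Definition drift_bound : R := 1 + 28 / del ^+ 2.

(** The cubic term of the drift, which is negative, absorbs the quadratic ones
    as soon as the backlog exceeds [2 / del]. *)
Let drift s : q * z (true :: s) ^+ 4 + (1 - q) * z (false :: s) ^+ 4 <=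
  z s ^+ 4 - z s ^+ 2 + drift_bound.
Proof.
move: q_half q1 => h1 h2.
have d2 : 0 < del ^+ 2 by rewrite exprn_gt0.
have C1 : 1 <= drift_bound by rewrite /drift_bound lerDl divr_ge0 ?ltW.
rewrite /=; case: (backlog s) => [|k].
  by rewrite !expr0n /= expr1n !mulr0 add0r subr0 add0r mulr1; lra.
rewrite -[k.+2%:R]natr1; set x : R := k.+1%:R.
have -> : k.+1.-1%:R = x - 1 :> R by rewrite /x -natr1 addrK.
have x1 : 1 <= x by rewrite /x ler1n.
suff : 7 * x ^+ 2 - 4 * del * x ^+ 3 + 1 <= drift_bound.
  have : q * (x - 1) ^+ 4 + (1 - q) * (x + 1) ^+ 4 =
    x ^+ 4 - 4 * del * x ^+ 3 + 6 * x ^+ 2 - 4 * del * x + 1 by rewrite /del; ring.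
  have : 0 <= del * x by rewrite mulr_ge0 ?ltW//; lra.
  lra.
have [xd|xd] := leP 2 (x * del).
  have : x ^+ 2 * 2 <= x ^+ 2 * (x * del) by rewrite ler_wpM2l// sqr_ge0.
  rewrite exprS; nra.
rewrite /drift_bound addrC lerD2l.
have : x ^+ 2 <= 4 / del ^+ 2.
  rewrite ler_pdivlMr// -exprMn; have : 0 <= x * del by rewrite mulr_ge0 ?ltW//; lra.
  nra.
have : 0 <= del * x ^+ 3 by rewrite mulr_ge0 ?ltW// exprn_gt0//; lra.
lra.
Qed.

Lemma backlog_moments n :
  mean q n (fun s => z s ^+ 4) + \sum_(i < n) mean q i (fun s => z s ^+ 2) <= drift_bound * n%:R.
Proof.
elim: n => [|n IH]; first by rewrite big_ord0 /= expr0n /= !mulr0 addr0.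
rewrite big_ord_recr /= -natr1 mulrDr mulr1.
have := ler_mean (n := n) q01 (fun s _ => drift s).
have -> : mean q n (fun s => z s ^+ 4 - z s ^+ 2 + drift_bound) =
    mean q n (fun s => z s ^+ 4) - mean q n (fun s => z s ^+ 2) + drift_bound.
  rewrite meanD mean_cst; congr (_ + _).
  by rewrite -mulN1r -meanZ -meanD; apply: eq_mean => s _; ring.
rewrite /=; lra.
Qed.

Lemma mean_backlog_sq n : \sum_(i < n) mean q i (fun s => z s ^+ 2) <= drift_bound * n%:R.
Proof.
apply: le_trans (backlog_moments n); rewrite lerDr -[leLHS](mean_cst q n 0).
by apply: ler_mean => // s _; rewrite exprn_ge0.
Qed.

Lemma mean_backlog_fourth n : mean q n (fun s => z s ^+ 4) <= drift_bound * n%:R.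
Proof.
apply: le_trans (backlog_moments n); rewrite lerDl sumr_ge0// => i _.
rewrite -[leLHS](mean_cst q i 0); by apply: ler_mean => // s _; rewrite exprn_ge0.
Qed.

(** Up to sign, the sum of the centred increments weighted by the backlog that they
    meet, by [X_cons]: a martingale as bits are added in front. *)
Let X s : R := del * (total_backlog s)%:R - (tokens s)%:R + (z s ^+ 2 + z s) / 2.

Let X_cons b s : X (b :: s) = X s - ((if b then 1 else -1) - del) * z s.
Proof.
rewrite /X /tokens /= natrD natrD; case: b => /=; last by rewrite -natr1; field.
by case: (backlog s) => [|k] /=; [rewrite !mulr0n; field|rewrite -[k.+1%:R]natr1 /=; field].
Qed.

Let mean_X_sq n : mean q n (fun s => X s ^+ 2) = 4 * q * (1 - q) * \sum_(i < n) mean q i (fun s => z s ^+ 2).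
Proof.
elim: n => [|n IH]; first by rewrite big_ord0 /= /X /= !mulr0n; field.
rewrite big_ord_recr /= mulrDr -IH -meanZ -meanD; apply: eq_mean => s _.
rewrite !X_cons /del; ring.
Qed.

(** By definition of [X], [del * total_backlog] differs from the number of tokens
    by the martingale [X] and a boundary term of the order of the squared backlog;
    each of the three has a centred second moment of order [n]. *)
Lemma mean_total_backlog_sq n :
  mean q n (fun s => ((total_backlog s)%:R - (1 - q) / del * (size s)%:R) ^+ 2) <=
  3 * (2 * drift_bound + 1) / del ^+ 2 * n%:R.
Proof.
move: q_half q1 => h1 h2.
have d2 : 0 < del ^+ 2 by rewrite exprn_gt0.
have -> : mean q n (fun s => ((total_backlog s)%:R - (1 - q) / del * (size s)%:R) ^+ 2) =
   (del ^+ 2)^-1 * mean q n (fun s => (del * (total_backlog s)%:R - (1 - q) * (size s)%:R) ^+ 2).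
  by rewrite -meanZ; apply: eq_mean => s _; field; rewrite gt_eqF.
rewrite [X in _ <= X](_ : _ = (del ^+ 2)^-1 * (3 * (2 * drift_bound + 1) * n%:R)); last by field; rewrite gt_eqF.
rewrite ler_pM2l ?invr_gt0//.
apply: (@le_trans _ _ (mean q n (fun s => 3 * (X s ^+ 2 + (((tokens s)%:R - (1 - q) * (size s)%:R) ^+ 2 + z s ^+ 4))))).
  apply: ler_mean => // s _.
  set a := X s; set b := (tokens s)%:R - _; pose c := (z s ^+ 2 + z s) / 2.
  have -> : del * (total_backlog s)%:R - (1 - q) * (size s)%:R = a + b - c.
    by rewrite /a /b /c /X; ring.
  have c4 : c ^+ 2 <= z s ^+ 4.
    have z2 : z s <= z s ^+ 2.
      by rewrite -natrX ler_nat; case: (backlog s) => // k; rewrite expnS leq_pmulr.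
    have c0 : 0 <= c by rewrite /c; have := ler0n R (backlog s); lra.
    have : c <= z s ^+ 2 by rewrite /c; lra.
    rewrite (_ : z s ^+ 4 = (z s ^+ 2) ^+ 2); last by ring.
    by move=> cz; rewrite lerXn2r// nnegrE// exprn_ge0.
  have := sqr_ge0 (a - b); have := sqr_ge0 (a + c); have := sqr_ge0 (b + c); lra.
rewrite meanZ !meanD -mulrA ler_pM2l// mulrDl mul1r.
have := mean_backlog_fourth n; have := mean_backlog_sq n.
rewrite mean_X_sq mean_tokens_sq.
set S := \sum_(i < n) _ => SC F.
have S0 : 0 <= S.
  by apply: sumr_ge0 => i _; rewrite -[leLHS](mean_cst q i 0); apply: ler_mean => // s _; rewrite exprn_ge0.
have q4 : 4 * q * (1 - q) <= 1 by have := sqr_ge0 (2 * q - 1); lra.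
have : 4 * q * (1 - q) * S <= S by rewrite -[leRHS]mul1r ler_wpM2r.
have : q * (1 - q) * n%:R <= n%:R by rewrite -[leRHS]mul1r ler_wpM2r//; lra.
lra.
Qed.
End moments.
End mean_theory.

(** * Linear programming duality for deletions *)

(** Charge a price [nu] for each deletion and minimise the total queue length plus
    the charges.  The constraints tie consecutive queue lengths, and a multiplier
    in [0, nu] for each of them is dual feasible when it falls by at most one from a
    slot to the next.  An arrival [b] followed by bits [s] of zero backlog is a job
    left behind, and deleting it is worth the full price: the multiplier restarts
    from [nu] there and otherwise falls by one until it vanishes. *)
Section credit.
Variable nu : nat.

Definition next_credit (y : nat) (b : bool) (s : seq bool) : nat :=
  if b && (backlog s == 0)%N then nu else y.-1.

(** [t] lists the bits that follow [u], on which the resets depend. *)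
Fixpoint credit (y : nat) (u t : seq bool) : nat :=
  if u is b :: u' then credit (next_credit y b (u' ++ t)) u' t else y.

Fixpoint funded (y : nat) (s : seq bool) : nat :=
  if s is b :: s' then
    (backlog s' * (0 < next_credit y b s') + funded (next_credit y b s') s')%N
  else 0%N.

Lemma next_credit_le y b s : (y <= nu)%N -> (next_credit y b s <= nu)%N.
Proof. by rewrite /next_credit; case: ifP => // _ h; rewrite (leq_trans (leq_pred _)). Qed.

Lemma next_credit_ge y b s : (y <= nu)%N -> (y.-1 <= next_credit y b s)%N.
Proof. by rewrite /next_credit; case: ifP => // _ h; rewrite (leq_trans (leq_pred _)). Qed.

Lemma credit_le y u t : (y <= nu)%N -> (credit y u t <= nu)%N.
Proof. by elim: u y => [//|b u IH] y yn /=; apply: IH; exact: next_credit_le. Qed.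

Lemma credit_ge y u t : (y <= nu)%N -> (y <= credit y u t + size u)%N.
Proof.
elim: u y => [|b u IH] y yn /=; first by rewrite addn0.
have := IH _ (next_credit_le b (u ++ t) yn); have := next_credit_ge b (u ++ t) yn; lia.
Qed.

Lemma credit_cat y u v t : credit y (u ++ v) t = credit (credit y u (v ++ t)) v t.
Proof. by elim: u y => [//|b u IH] y /=; rewrite IH catA. Qed.

(** Without a reset, every arrival of [u] lowers the backlog that follows it. *)
Lemma credit_reset y u t : (y <= nu)%N ->
  (nu < credit y u t + size u)%N \/
  (count id u + backlog (u ++ t) <= count negb u + backlog t)%N.
Proof.
elim: u y => [|b u IH] y yn /=; first by right.
have yn' := next_credit_le b (u ++ t) yn.
have cg := credit_ge u t yn'; have := IH _ yn'.
move: cg; rewrite {1}/next_credit; case: b yn' => /= yn'; last by lia.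
by case: eqP => [z0|]; [rewrite z0; lia|lia].
Qed.

Lemma credit0 u v t : size v = nu -> (0 < nu)%N -> credit nu (u ++ v) t = 0%N ->
  (count id v <= count negb v + backlog t)%N.
Proof.
move=> sv nu0; rewrite credit_cat.
by case: (credit_reset v t (credit_le u (v ++ t) (leqnn nu))); lia.
Qed.

Lemma total_backlogE s : total_backlog s = (\sum_(j < size s) backlog (drop j.+1 s))%N.
Proof. by elim: s => [|b s IH]; rewrite ?big_ord0// big_ord_recl /= drop0 IH. Qed.

Lemma fundedE y s : funded y s =
  (\sum_(j < size s) backlog (drop j.+1 s) * (0 < credit y (take j.+1 s) (drop j.+1 s)))%N.
Proof.
elim: s y => [|b s IH] y; rewrite ?big_ord0// big_ord_recl /= drop0 take0 /= IH.
by congr (_ + _)%N; apply: eq_bigr => j _; rewrite /= cat_take_drop.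
Qed.

(** What the dual value loses at the end of the path, where multipliers cannot
    exceed the number of remaining slots. *)
Definition slack (c : nat) : nat := \sum_(i < c) (nu - i.+1)%N.

Lemma slack_le c : (slack c <= nu * nu)%N.
Proof.
suff : (slack c <= nu * minn c nu)%N by move/leq_trans; apply; rewrite leq_mul2l geq_minr orbT.
elim: c => [|c IH]; first by rewrite /slack big_ord0.
rewrite /slack big_ord_recr /= -/(slack c); have [cn|cn] := ltnP c nu; nia.
Qed.

Let price (m : nat) (A B : int) (d : bool) : (m <= nu)%N -> A <= B + d%:Z ->
  m%:Z * A <= m%:Z * B + nu%:Z * d%:Z.
Proof. by case: d => mn AB; nia. Qed.

Let price_keep (y c F z v' SV L x : nat) (E A : int) (d : bool) : (y <= nu)%N ->
  A <= v'%:Z - z%:Z + d%:Z ->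
  F%:Z + nu%:Z * E + (minn y.-2 c)%:Z * (v'%:Z - z%:Z) - L%:Z <= SV%:Z ->
  (z * (0 < y.-1) + F)%N%:Z + nu%:Z * (E - d%:Z) + (minn y.-1 c.+1)%:Z * A - (L + x)%N%:Z
    <= (v' + SV)%N%:Z.
Proof.
move=> yn AB IH.
have Mn : (minn y.-1 c.+1 <= nu)%N by lia.
have := price Mn AB; rewrite mulrBr mulrBr.
have [y1|y2] := leqP y 1.
  have -> : minn y.-1 c.+1 = 0%N by lia.
  have -> : (0 < y.-1)%N = false by lia.
  have m0 : minn y.-2 c = 0%N by lia.
  move: IH; rewrite m0 !mul0r muln0; lia.
have -> : (0 < y.-1)%N by lia.
have -> : minn y.-1 c.+1 = (minn y.-2 c).+1 by lia.
move: IH; rewrite intS !mulrDl !mul1r muln1 mulrBr; lia.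
Qed.

(** Weak duality: the constraint of a slot with [c] bits after it enters with the
    multiplier [minn y c.+1], where [y] is its credit.  The term in
    [V 0 - backlog s] carries the share of [V 0] in the constraint of the first
    slot, which makes the induction on [s] go through; each arrival left behind adds one to the
    surplus plus the backlog. *)
Lemma dual_bound y s (V : nat -> nat) (dl : nat -> bool) : (0 < nu)%N -> (y <= nu)%N ->
  (forall k, (k < size s)%N ->
     if nth false s k then ((V k).+1 <= V k.+1 + dl k.+1)%N
     else (V k <= (V k.+1 + dl k.+1).+1)%N) ->
  (funded y s)%:Z + nu%:Z * ((count id s)%:Z - (count negb s)%:Z + (backlog s)%:Z
     - (\sum_(k < size s) dl k.+1)%N%:Z)
   + (minn y.-1 (size s))%:Z * ((V 0%N)%:Z - (backlog s)%:Z) - (slack (size s))%:Z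
   <= (\sum_(k < size s) V k.+1)%N%:Z.
Proof.
move=> nu0; elim: s y V dl => [|b s IH] y V dl yn step.
  by rewrite /= !big_ord0 /slack big_ord0 minn0; lia.
have /= step0 := step 0%N isT.
have := IH _ (V \o succn) (dl \o succn) (next_credit_le b s yn) (fun k ks => step k.+1 ks).
have eD : (\sum_(k < (size s).+1) dl k.+1 = dl 1%N + \sum_(k < size s) dl k.+2)%N.
  by rewrite big_ord_recl.
have eV : (\sum_(k < (size s).+1) V k.+1 = V 1%N + \sum_(k < size s) V k.+2)%N.
  by rewrite big_ord_recl.
have eL : slack (size s).+1 = (slack (size s) + (nu - (size s).+1))%N.
  by rewrite /slack big_ord_recr.
rewrite /= eD eV eL.
set D := (\sum_(i < size s) dl _)%N; set SV := (\sum_(i < size s) V _)%N.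
move: step0; rewrite /next_credit; clear step IH; set c := size s.
move: (V 0%N) (V 1%N) (slack c) (dl 1%N) => v v' L d.
case: b => /=; rewrite ?add0n ?add1n.
  case: eqP => [->|/eqP z0] /=.
    rewrite mul0n add0n; move: (funded _ s) => F.
    by case: d => /=; nia.
  move=> vd IH; have := @price_keep y c _ _ v' _ L (nu - c.+1) _ (v%:Z - (backlog s).-1%:Z) d yn _ IH.
  move=> H; apply: le_trans (H _); last by lia.
  rewrite lerD2r lerD2r lerD2l; apply: ler_wpM2l => //; lia.
move=> vd IH; have := @price_keep y c _ _ v' _ L (nu - c.+1) _ (v%:Z - (backlog s).+1%:Z) d yn _ IH.
move=> H; apply: le_trans (H _); last by lia.
rewrite lerD2r lerD2r lerD2l; apply: ler_wpM2l => //; lia.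
Qed.
End credit.

(** * The backlog not covered by the credit *)

Section late.
Context {R : realType}.
Variables (q : R) (nu : nat).
Hypotheses (q_half : 1 < 2 * q) (q1 : q <= 1) (nu0 : (0 < nu)%N).
Let del := 2 * q - 1.
Let del0 : 0 < del. Proof. by rewrite /del subr_gt0. Qed.
Let nuR : 0 < nu%:R :> R. Proof. by rewrite ltr0n. Qed.

Definition surplus (u : seq bool) : R := (count id u)%:R - (count negb u)%:R.

(** Typically [surplus u] is close to [del * nu] over [nu] slots.  If it is at most
    the backlog of the next bits [t], either that backlog or the deviation of the
    surplus reaches half of [del * nu]; each term covers one case, and both have
    moments that are small for large [nu]. *)
Definition late_cost (u t : seq bool) : R :=
  (backlog t)%:R * (2 * (backlog t)%:R / (del * nu%:R)
     + 4 * (surplus u - del * nu%:R) ^+ 2 / (del * nu%:R) ^+ 2).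

Definition late (s : seq bool) : R :=
  \sum_(0 <= k < (size s).+1 - nu) late_cost (take nu (drop k s)) (drop (k + nu) s).

Let late_cost_ge0 u t : 0 <= late_cost u t.
Proof.
have dn : 0 < del * nu%:R by rewrite mulr_gt0.
apply: mulr_ge0 => //; apply: addr_ge0.
  by apply: divr_ge0; [exact: mulr_ge0|exact: ltW].
by apply: divr_ge0; [apply: mulr_ge0 => //; exact: sqr_ge0|exact: sqr_ge0].
Qed.

Let late_cost_ge u t : (count id u <= count negb u + backlog t)%N ->
  (backlog t)%:R <= late_cost u t.
Proof.
move=> h; have dn : 0 < del * nu%:R by rewrite mulr_gt0.
rewrite /late_cost -[leLHS]mulr1; apply: ler_wpM2l => //.
have sz : surplus u <= (backlog t)%:R by rewrite /surplus lerBlDl -natrD ler_nat.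
set z : R := (backlog t)%:R in sz *; set x := del * nu%:R in dn *.
have z0 : 0 <= z by rewrite /z.
have t1 : 0 <= 2 * z / x by apply: divr_ge0; [exact: mulr_ge0|exact: ltW].
have t2 : 0 <= 4 * (surplus u - x) ^+ 2 / x ^+ 2.
  by apply: divr_ge0; [apply: mulr_ge0 => //; exact: sqr_ge0|exact: sqr_ge0].
have [zx|zx] := leP x (2 * z).
  apply: (@le_trans _ _ (2 * z / x)); first by rewrite ler_pdivlMr// mul1r.
  by rewrite lerDl.
apply: (@le_trans _ _ (4 * (surplus u - x) ^+ 2 / x ^+ 2)); last by rewrite lerDr.
rewrite ler_pdivlMr ?exprn_gt0// mul1r.
have : x / 2 <= x - surplus u by lra.
have : 0 < x / 2 by lra.
nra.
Qed.

Lemma late_ge0 s : 0 <= late s.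
Proof. by apply: sumr_ge0 => k _; exact: late_cost_ge0. Qed.

(** A vanishing credit means that no arrival among the last [nu] slots was left
    behind, so that [credit0] bounds their surplus by the present backlog. *)
Lemma total_backlog_le s :
  (total_backlog s)%:R <= (funded nu nu s)%:R + late s.
Proof.
rewrite total_backlogE fundedE !natr_sum -lerBlDl -sumrB.
pose F j : R := if credit nu nu (take j s) (drop j s) == 0%N then (backlog (drop j s))%:R else 0.
have -> : \sum_(j < size s) ((backlog (drop j.+1 s))%:R -
    (backlog (drop j.+1 s) * (0 < credit nu nu (take j.+1 s) (drop j.+1 s)))%N%:R) =
    \sum_(0 <= j < size s) F j.+1 :> R.
  rewrite big_mkord; apply: eq_bigr => j _; rewrite /F lt0n.
  by case: eqP => _ /=; rewrite ?muln0 ?muln1 ?subr0 ?subrr.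
have [sn|sn] := ltnP (size s) nu.
  rewrite big1_seq /=; last first.
    move=> j; rewrite mem_index_iota /= => js; rewrite /F; case: eqP => // c0.
    have := credit_ge (take j.+1 s) (drop j.+1 s) (leqnn nu).
    by rewrite c0 size_take; case: ifP => ?; lia.
  by rewrite /late (_ : _ - nu = 0)%N ?big_geq//; lia.
have -> : \sum_(0 <= j < size s) F j.+1 = \sum_(1 <= j < (size s).+1) F j.
  by rewrite big_add1.
rewrite (big_cat_nat _ _ (n := nu)) //=; last by lia.
rewrite big1_seq /= ?add0r; last first.
  move=> j; rewrite mem_index_iota /= => js; rewrite /F; case: eqP => // c0.
  have := credit_ge (take j s) (drop j s) (leqnn nu).
  by rewrite c0 size_take; case: ifP => ?; lia.
rewrite -{1}(add0n nu) big_addn /late; apply: ler_sum_nat => k /= kn.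
rewrite /F; case: eqP => [c0|_]; last exact: late_cost_ge0.
apply: late_cost_ge; set u := take nu (drop k s).
have su : size u = nu by rewrite /u size_takel// size_drop; lia.
have e : take (k + nu) s = take k s ++ u by rewrite /u takeD.
by move: c0; rewrite e; exact: credit0.
Qed.

(** The [nu] bits of the window and the bits after it are independent, the surplus
    of the window has variance [4 * q * (1 - q) * nu], and the squared backlogs sum
    to at most [drift_bound q * N] in the mean. *)
Lemma mean_late N : mean q N late <= 6 * drift_bound q / (del ^+ 2 * nu%:R) * N%:R.
Proof.
have hq := q_half; have hq1 := q1.
have q01 : 0 <= q <= 1 by apply/andP; split; lra.
have dn : 0 < del * nu%:R by rewrite mulr_gt0.
pose M2 m := mean q m (fun t => (backlog t)%:R ^+ 2).
have M20 m : 0 <= M2 m.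
  by rewrite /M2 -[leLHS](mean_cst q m 0); apply: ler_mean => // t _; exact: sqr_ge0.
pose a : R := 6 / (del ^+ 2 * nu%:R).
have a0 : 0 <= a by rewrite divr_ge0// mulr_ge0// ?sqr_ge0.
have -> : mean q N late = \sum_(0 <= k < N.+1 - nu)
    mean q N (fun s => late_cost (take nu (drop k s)) (drop (k + nu) s)).
  by rewrite -mean_sum; apply: eq_mean => s sN; rewrite /late sN.
have term k m : mean q (k + (nu + m)) (fun s => late_cost (take nu (drop k s)) (drop (k + nu) s))
    <= a * M2 m.
  rewrite mean_cat (_ : mean q k _ = mean q nu (fun u => mean q m (fun t => late_cost u t))); last first.
    rewrite -[RHS](mean_cst q k); apply: eq_mean => s1 s1k.
    rewrite mean_cat; apply: eq_mean => u un; apply: eq_mean => t _.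
    by rewrite (addnC k nu) -drop_drop !drop_size_cat// take_size_cat.
  pose b : R := 2 / (del * nu%:R); pose c : R := 4 / (del * nu%:R) ^+ 2.
  have M1 : mean q m (fun t => (backlog t)%:R) <= M2 m.
    apply: ler_mean => // t _; rewrite -natrX ler_nat.
    by case: (backlog t) => // x; rewrite expnS leq_pmulr.
  have M10 : 0 <= mean q m (fun t => (backlog t)%:R : R).
    by rewrite -[leLHS](mean_cst q m 0); apply: ler_mean.
  have -> : mean q nu (fun u => mean q m (fun t => late_cost u t)) =
    b * M2 m + mean q m (fun t => (backlog t)%:R) * c * mean q nu (fun u => (surplus u - del * nu%:R) ^+ 2).
    rewrite -(mean_cst q nu (b * M2 m)) -meanZ -meanD; apply: eq_mean => u _.
    rewrite /M2 -meanZ -mulrA mulrC -meanZ -meanD; apply: eq_mean => t _.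
    by rewrite /late_cost /b /c; ring.
  have -> : mean q nu (fun u => (surplus u - del * nu%:R) ^+ 2) = 4 * (q * (1 - q) * nu%:R).
    rewrite -mean_tokens_sq// -meanZ; apply: eq_mean => u un.
    have -> : surplus u = (size u)%:R - 2 * (tokens u)%:R.
      by rewrite /surplus /tokens -(count_predC id u) natrD; ring.
    by rewrite un /del; ring.
  have q4 : 4 * q * (1 - q) <= 1 by have := sqr_ge0 (2 * q - 1); lra.
  have cE : c * (4 * (q * (1 - q) * nu%:R)) <= 4 / (del ^+ 2 * nu%:R).
    rewrite [leLHS](_ : _ = (4 / (del ^+ 2 * nu%:R)) * (4 * q * (1 - q))).
      by rewrite ger_pMr// divr_gt0// mulr_gt0// exprn_gt0.
    by rewrite /c; field; rewrite !gt_eqF.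
  have bE : b <= 2 / (del ^+ 2 * nu%:R).
    rewrite /b ler_pM2l// lef_pV2 ?posrE ?mulr_gt0 ?exprn_gt0//.
    rewrite ler_pM2r// expr2 ger_pMr// /del; lra.
  have -> : a * M2 m = 2 / (del ^+ 2 * nu%:R) * M2 m + M2 m * (4 / (del ^+ 2 * nu%:R)).
    by rewrite /a; field; rewrite !gt_eqF.
  apply: lerD; first exact: ler_wpM2r.
  rewrite -mulrA; apply: ler_pM => //.
  have qq : 0 <= q * (1 - q) by apply: mulr_ge0; lra.
  apply: mulr_ge0; first by rewrite /c divr_ge0// sqr_ge0.
  by apply: mulr_ge0 => //; exact: mulr_ge0.
have [Nnu|Nnu] := ltnP N nu.
  rewrite (_ : N.+1 - nu = 0)%N; last by lia.
  rewrite big_geq//; apply: mulr_ge0 => //; apply: divr_ge0.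
    by apply: mulr_ge0 => //; rewrite /drift_bound addr_ge0// divr_ge0// sqr_ge0.
  by apply: mulr_ge0; [exact: sqr_ge0|exact: ltW].
apply: (@le_trans _ _ (\sum_(0 <= k < N.+1 - nu) a * M2 (N - nu - k)%N)).
  apply: ler_sum_nat => k /= kN; have := term k (N - nu - k)%N.
  by have -> : (k + (nu + (N - nu - k)) = N)%N by lia.
rewrite -mulr_sumr [leRHS](_ : _ = a * (drift_bound q * N%:R)); last by rewrite /a; field; rewrite !gt_eqF.
apply: ler_wpM2l => //; apply: le_trans (mean_backlog_sq q_half q1 N).
rewrite big_nat_rev /= -(big_mkord xpredT M2) [leRHS](big_cat_nat _ _ (n := (N.+1 - nu)%N)) //=; last by lia.
rewrite -[leLHS]addr0; apply: lerD; last by apply: sumr_ge0.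
by apply: ler_sum_nat => k /= kN; rewrite (_ : N - nu - _ = k)%N//; lia.
Qed.

(** The path is arbitrary, and so are the deletions: this bound also binds rules that
    know the whole path. *)
Lemma deletion_lower_bound s (V : nat -> nat) (dl : nat -> bool) : V 0%N = 0%N ->
  (forall k, (k < size s)%N ->
     if nth false s k then ((V k).+1 <= V k.+1 + dl k.+1)%N
     else (V k <= (V k.+1 + dl k.+1).+1)%N) ->
  (total_backlog s)%:R - late s + nu%:R * (surplus s - (\sum_(k < size s) dl k.+1)%N%:R)
   - (nu * nu)%:R <= (\sum_(k < size s) V k.+1)%N%:R.
Proof.
move=> V0 step; have := dual_bound nu0 (leqnn nu) step; rewrite V0 sub0r.
set D := (\sum_(k < size s) dl _)%N; set SV := (\sum_(k < size s) V _)%N => H.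
have {H} : (funded nu nu s)%:Z + nu%:Z * ((count id s)%:Z - (count negb s)%:Z - D%:Z) - (nu * nu)%N%:Z <= SV%:Z.
  apply: le_trans H; have := slack_le nu (size s).
  have m1 : (minn nu.-1 (size s) <= nu)%N by lia.
  move: (minn _ _) m1 => mm m1 sl; nia.
rewrite -(ler_int R) !(rmorphD, rmorphB, rmorphM, rmorphN) /= -!pmulrn => H.
apply: le_trans H; rewrite /surplus; have := total_backlog_le s; lra.
Qed.
End late.

(** * A strong law of large numbers for independent bits *)

Fixpoint bit_lists (n : nat) : seq (seq bool) :=
  if n is k.+1 then map (cons true) (bit_lists k) ++ map (cons false) (bit_lists k)
  else [:: [::]].

Lemma mem_bit_lists n s : (s \in bit_lists n) = (size s == n).
Proof.
elim: n s => [|n IH] [|b s] //=.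
  by rewrite mem_cat; apply/negbTE; rewrite negb_or; apply/andP; split; apply/negP => /mapP[].
rewrite mem_cat eqSS -IH; case: b.
  rewrite (mem_map (f := cons true)) => [|x y [] //]; case: (s \in _) => //=.
  by apply/negbTE/negP => /mapP[].
rewrite orbC (mem_map (f := cons false)) => [|x y [] //]; case: (s \in _) => //=.
by apply/negbTE/negP => /mapP[].
Qed.

Lemma bit_lists_uniq n : uniq (bit_lists n).
Proof.
elim: n => [//|n IH] /=; rewrite cat_uniq !map_inj_uniq ?IH; try by move=> x y [].
by rewrite andbT /= -all_predC; apply/allP => s /mapP[t _ ->]; apply/negP => /mapP[].
Qed.

Lemma meanE (R : realType) (q : R) n f :
  mean q n f = \sum_(s <- bit_lists n) coin_law q s * f s.
Proof.
elim: n f => [|n IH] f; first by rewrite big_seq1 /coin_law big_nil mul1r.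
rewrite mean_cons !IH /= big_cat !big_map !mulr_sumr; congr (_ + _);
  by apply: eq_bigr => s _; rewrite /coin_law big_cons mulrA.
Qed.

Section coin.
Context d (T : measurableType d) (R : realType) (P : probability T R).
Variables (q : R) (b : T -> nat -> bool).
Hypotheses (q01 : 0 <= q <= 1) (cb : coin_flips P q b).

Definition prefix (w : T) n : seq bool := mkseq (b w) n.

Lemma size_prefix w n : size (prefix w n) = n. Proof. exact: size_mkseq. Qed.

Lemma measurable_prefix_fun (f : seq bool -> R) n :
  measurable_fun setT (fun w => f (prefix w n)).
Proof.
case: cb => mb _ _ B mB; rewrite setTI.
rewrite (_ : _ @^-1` _ = \bigcup_(s in [set s | B (f s)]) [set w | prefix w n = s]).
  rewrite -(sigma_algebra_id (@sigma_algebra_measurable _ T)).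
  apply: sigma_bigcup => s _; rewrite (sigma_algebra_id (@sigma_algebra_measurable _ T)).
  exact: measurable_prefix.
by apply/seteqP; split => w /=; [move=> ?; exists (prefix w n)|move=> [s Bs ->]].
Qed.

Lemma integral_prefix (f : seq bool -> R) n : (forall s, 0 <= f s) ->
  (\int[P]_w (f (prefix w n))%:E)%E = (mean q n f)%:E.
Proof.
move=> f0; case: cb => mb law.
have mp s : measurable [set w | prefix w n = s] by exact: measurable_prefix.
transitivity (\int[P]_w (\sum_(s <- bit_lists n) (f s)%:E * (\1_[set w | prefix w n = s] w)%:E))%E.
  apply: eq_integral => w _.
  rewrite (bigD1_seq (prefix w n)) ?mem_bit_lists ?size_prefix ?bit_lists_uniq//=.
  rewrite indicE mem_set// mule1 big1 ?adde0// => s sw.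
  by rewrite indicE memNset ?mule0// => ws; rewrite ws eqxx in sw.
rewrite ge0_integral_sum//; last 2 first.
- move=> s; apply: emeasurable_funM => //.
  by apply/measurable_EFinP; exact: measurable_indic.
- by move=> s w _; rewrite mule_ge0 ?lee_fin.
rewrite meanE -sumEFin big_seq [RHS]big_seq; apply: eq_bigr => s.
rewrite mem_bit_lists => /eqP sn.
rewrite ge0_integralZl//; last 2 first.
- by apply/measurable_EFinP; exact: measurable_indic.
- by rewrite lee_fin.
rewrite integral_indic// setIT.
transitivity ((f s)%:E * P [set w | prefix w n = s])%E => //.
by rewrite -sn law -EFinM mulrC.
Qed.
End coin.

(** The ratio of consecutive squares tends to 1, which leaves a monotone sequence
    no room between them. *)
Lemma cvg_squares (R : realType) (a : nat -> nat) (c : R) : 0 <= c ->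
  (forall n, (a n <= a n.+1)%N) ->
  (fun k => (a (k.+1 ^ 2)%N)%:R / (k.+1 ^ 2)%:R : R) @ \oo --> c ->
  (fun n => (a n)%:R / n%:R : R) @ \oo --> c.
Proof.
move=> c0 aS; have am i j : (i <= j)%N -> (a i <= a j)%N.
  move=> ij; rewrite -(subnKC ij); elim: (j - i)%N => [|k IH]; rewrite ?addn0 ?addnS//.
  exact: leq_trans IH (aS _).
move=> /cvgrPdist_le ac; apply/cvgrPdist_le => e e0.
have e2 : 0 < e / 2 by lra.
have [N _ hN] := ac _ e2.
have bnd k : (N < k)%N -> (c - e / 2) * (k%:R ^+ 2) <= (a (k ^ 2)%N)%:R <= (c + e / 2) * (k%:R ^+ 2).
  case: k => // k; rewrite ltnS => Nk; have := hN k Nk; rewrite /= natrX ler_norml => /andP[h1 h2].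
  have k2 : 0 < k.+1%:R ^+ 2 :> R by rewrite exprn_gt0.
  apply/andP; split; [rewrite -ler_pdivlMr//|rewrite -ler_pdivrMr//];
    move: h1 h2; move: ((a _)%:R / _) => y h1 h2; lra.
(* Beyond [K], the relative gap between consecutive squares costs less than [e / 2]. *)
pose K := (Num.truncn (6 * (c + e / 2) / e)).+1.
have KP : 6 * (c + e / 2) <= e * K%:R.
  by rewrite [leRHS]mulrC -ler_pdivrMr//; apply: ltW; exact: truncnS_gt.
exists ((N + K).+2 ^ 2)%N => // n /= nN.
have n0 : (0 < n)%N by apply: leq_trans nN.
have [k [k1 k2]] : exists k, (k ^ 2 <= n)%N /\ (n < k.+1 ^ 2)%N.
  clear -n; elim: n => [|n [k [h1 h2]]]; first by exists 0%N.
  have [h|h] := ltnP n.+1 (k.+1 ^ 2); first by exists k; split => //; exact: ltnW.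
  by exists k.+1; split => //; nia.
have kN : (N + K < k)%N by nia.
have nR : 0 < n%:R :> R by rewrite ltr0n.
have /andP[l1 _] := bnd k (leq_ltn_trans (leq_addr _ _) kN).
have kN' : (N < k.+1)%N by lia.
have /andP[_ l2] := bnd k.+1 kN'.
have a1 : ((a (k ^ 2)%N)%:R <= (a n)%:R :> R) by rewrite ler_nat am.
have a2 : ((a n)%:R <= (a (k.+1 ^ 2)%N)%:R :> R) by rewrite ler_nat am// ltnW.
have kn1 : k%:R ^+ 2 <= n%:R :> R by rewrite -natrX ler_nat.
have kn2 : n%:R + 1 <= k.+1%:R ^+ 2 :> R by rewrite -natrX natr1 ler_nat.
have Kk : K%:R + 1 <= k%:R :> R by rewrite natr1 ler_nat (leq_ltn_trans (leq_addl N K) kN).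
have K0 : 0 <= K%:R :> R by [].
have an0 : 0 <= (a n)%:R :> R by [].
rewrite -[k.+1%:R]natr1 in l2 kn2.
move: ((a (k ^ 2)%N)%:R : R) ((a (k.+1 ^ 2)%N)%:R : R) a1 a2 l1 l2 => u v.
move: ((a n)%:R : R) an0 => an an0 a1 a2 l1 l2.
move: (k%:R) (K%:R) (n%:R) nR Kk K0 kn1 kn2 l1 l2 KP => x y m m0 yx y0 xm mx l1 l2 KP.
clear - c0 e0 a1 a2 an0 m0 yx y0 xm mx l1 l2 KP.
have KP' : 6 * (c + e / 2) * x <= e * x ^+ 2.
  rewrite expr2 mulrA; apply: ler_wpM2r; first by lra.
  apply: le_trans KP _; apply: ler_wpM2l; lra.
have x2 : x <= x ^+ 2 by rewrite expr2 ler_peMl//; lra.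
rewrite ler_norml; apply/andP; split.
  suff : an / m <= c + e by move: (an / m) => r' h; lra.
  rewrite ler_pdivrMr//; apply: le_trans a2 (le_trans l2 _).
  apply: (@le_trans _ _ ((c + e) * x ^+ 2)); last by apply: ler_wpM2l => //; lra.
  have : (c + e / 2) * (2 * x + 1) <= (c + e / 2) * (3 * x) by apply: ler_wpM2l; lra.
  lra.
suff : c - e <= an / m by move: (an / m) => r' h; lra.
rewrite ler_pdivlMr//.
have [ce|ce] := leP (c - e) 0.
  by apply: le_trans an0; apply: mulr_le0_ge0 => //; exact: ltW.
apply: le_trans a1; apply: le_trans l1.
apply: (@le_trans _ _ ((c - e) * (x ^+ 2 + 2 * x))); first by apply: ler_wpM2l; [exact: ltW|lra].
have : e * x >= 0 by apply: mulr_ge0; lra.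
have : 0 <= e * x ^+ 2 by apply: mulr_ge0; [exact: ltW|exact: sqr_ge0].
lra.
Qed.

Lemma sum_inv_squares (R : realType) n :
  \sum_(0 <= k < n) (k.+1%:R ^+ 2)^-1 <= 2 - 2 * n.+1%:R^-1 :> R.
Proof.
elim: n => [|n IH]; first by rewrite big_nil invr1; lra.
rewrite big_nat_recr //=; apply: le_trans (lerD IH (lexx _)) _.
rewrite -lerBrDl -[n.+2%:R]natr1; set x : R := n.+1%:R.
have x1 : 1 <= x by rewrite ler1n.
have -> : 2 - 2 * (x + 1)^-1 - (2 - 2 * x^-1) = (x ^+ 2)^-1 * (2 * x / (x + 1)).
  by field; rewrite !gt_eqF//; lra.
rewrite ler_peMr// ?invr_ge0 ?sqr_ge0//.
by rewrite ler_pdivlMr; lra.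
Qed.

Lemma nneseries_lty_cvg0 (R : realType) (u : nat -> R) : (forall n, 0 <= u n) ->
  (\sum_(k <oo) (u k)%:E < +oo)%E -> u @ \oo --> 0.
Proof.
move=> u0 us.
have uE k : (0 <= k)%N -> true -> (0 <= (u k)%:E)%E by rewrite lee_fin.
have t0 := nneseries_tail_cvg us (fun k _ => uE k isT isT).
have ut : (fun k => (u k)%:E) @ \oo --> 0%:E.
  apply: (squeeze_cvge _ (cvg_cst 0%E) t0); apply: nearW => k /=; rewrite lee_fin u0 /=.
  have := @nneseries_lim_ge R (fun k => (u k)%:E) xpredT k k.+1 (fun n _ => uE n isT).
  by rewrite big_nat1.
by have /fine_cvgP [] := ut.
Qed.

Section lln.
Context d (T : measurableType d) (R : realType) (P : probability T R).
Variables (q : R) (b : T -> nat -> bool).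
Hypotheses (q01 : 0 <= q <= 1) (cb : coin_flips P q b).
Notation prefix := (prefix b).

Lemma prefixS w n : prefix w n.+1 = rcons (prefix w n) (b w n).
Proof. exact: mkseqS. Qed.

(** A second moment of order [n] is summable along the squares; monotonicity
    fills the gaps. *)
Lemma strong_law (g : seq bool -> nat) (c C : R) : 0 <= c -> 0 <= C ->
  (forall s a, (g s <= g (rcons s a))%N) ->
  (forall n, mean q n (fun s => ((g s)%:R - c * (size s)%:R) ^+ 2) <= C * n%:R) ->
  {ae P, forall w, (fun n => (g (prefix w n))%:R / n%:R : R) @ \oo --> c}.
Proof.
move=> c0 C0 gS gC.
pose K k := (k.+1 ^ 2)%N.
have KR k : (K k)%:R = k.+1%:R ^+ 2 :> R by rewrite natrX.
have K0 k : 0 < (K k)%:R :> R by rewrite ltr0n expn_gt0.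
pose f k (s : seq bool) : R := (((g s)%:R - c * (size s)%:R) / (K k)%:R) ^+ 2.
have f0 k s : 0 <= f k s by exact: sqr_ge0.
pose h k w : \bar R := (f k (prefix w (K k)))%:E.
have mh k : measurable_fun setT (h k).
  by apply/measurable_EFinP; exact: (measurable_prefix_fun cb).
have h0 k w : (0 <= h k w)%E by rewrite lee_fin.
have Eh k : (\int[P]_w h k w <= (C * (k.+1%:R ^+ 2)^-1)%:E)%E.
  rewrite (integral_prefix cb)// lee_fin.
  rewrite (_ : mean q (K k) (f k) = ((K k)%:R ^+ 2)^-1 *
     mean q (K k) (fun s => ((g s)%:R - c * (size s)%:R) ^+ 2)); last first.
    by rewrite -meanZ; apply: eq_mean => s _; rewrite /f exprMn exprVn mulrC.
  rewrite mulrC ler_pdivrMr ?exprn_gt0//; apply: le_trans (gC _) _.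
  by rewrite -KR expr2 mulrA mulfVK// gt_eqF.
have int_lty : (\int[P]_w (\sum_(k <oo) h k w) < +oo)%E.
  rewrite integral_nneseries//; apply: (@le_lt_trans _ _ (C * 2)%:E); last exact: ltry.
  apply: lime_le; first by apply: is_cvg_nneseries => k _ _; exact: integral_ge0.
  apply: nearW => n; apply: (@le_trans _ _ (\sum_(0 <= k < n) (C * (k.+1%:R ^+ 2)^-1)%:E)%E).
    by apply: lee_sum.
  rewrite sumEFin lee_fin -mulr_sumr; apply: ler_wpM2l => //.
  by apply: le_trans (sum_inv_squares R n) _; rewrite gerBl mulr_ge0// invr_ge0.
have msum : measurable_fun setT (fun w => \sum_(k <oo) h k w)%E.
  exact: ge0_emeasurable_sum.
have sum_int : P.-integrable setT (fun w => \sum_(k <oo) h k w)%E.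
  apply/integrableP; split => //.
  under eq_integral do rewrite gee0_abs ?nneseries_ge0//.
  exact: int_lty.
apply: filterS (integrable_ae measurableT sum_int) => w hw.
have hfin : (\sum_(k <oo) h k w < +oo)%E by rewrite ltey_eq (hw I).
have f_cvg := nneseries_lty_cvg0 (fun k => f0 k (prefix w (K k))) hfin.
apply: cvg_squares => //; first by move=> n; rewrite prefixS.
apply/cvgrPdist_le => e e0.
move/cvgrPdist_le: f_cvg => /(_ (e ^+ 2) (exprn_gt0 _ e0)).
apply: filterS => k; rewrite sub0r normrN ger0_norm ?f0// /f size_prefix => he.
have E : ((g (prefix w (K k)))%:R - c * (K k)%:R) / (K k)%:R = (g (prefix w (K k)))%:R / (K k)%:R - c.
  by rewrite mulrBl mulfK// gt_eqF.
move: he; rewrite E -real_normK ?num_real//.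
by rewrite ler_sqr ?nnegrE ?(ltW e0)// distrC.
Qed.
End lln.

(** * Upper limits, and integrals of arbitrary nonnegative functions *)

Section limn_esup_theory.
Context {R : realType}.
Implicit Types (u : nat -> \bar R) (x : \bar R).

Lemma limn_esup_le u x : (\forall n \near \oo, (u n <= x)%E) -> (limn_esup u <= x)%E.
Proof.
move=> [N _ h]; rewrite /limn_esup limf_esupE; apply: ge_ereal_inf.
exists (ereal_sup (u @` [set n | (N <= n)%N])); first by exists [set n | (N <= n)%N] => //; exists N.
by apply: ge_ereal_sup => _ [n Nn <-]; exact: h.
Qed.

Lemma limn_esup_lt u x : (limn_esup u < x)%E -> \forall n \near \oo, (u n < x)%E.
Proof.
rewrite /limn_esup limf_esupE => /ereal_inf_lt[_ [V Vo <-] ux].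
by apply: filterS Vo => n Vn; apply: le_lt_trans ux; apply: ereal_sup_ubound; exists n.
Qed.

Lemma limn_esup_ge0 u : (forall n, (0 <= u n)%E) -> (0 <= limn_esup u)%E.
Proof.
move=> u0; rewrite /limn_esup limf_esupE; apply: le_ereal_inf_tmp => _ [V [N _ NV] <-].
by apply: le_trans (u0 N) _; apply: ereal_sup_ubound; exists N => //; apply: NV => /=.
Qed.

Lemma limn_einf_ge u x : (\forall n \near \oo, (x <= u n)%E) -> (x <= limn_einf u)%E.
Proof.
move=> h; rewrite /limn_einf leeNr; apply: limn_esup_le.
by apply: filterS h => n; rewrite leeN2.
Qed.

Lemma limn_einf_le u x : (forall n, (u n <= x)%E) -> (limn_einf u <= x)%E.
Proof.
move=> h; apply: le_trans (limn_einf_sup u) _; apply: limn_esup_le; exact: nearW.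
Qed.

End limn_esup_theory.

Section lower_integral.
Context d (T : measurableType d) (R : realType) (P : probability T R).
Implicit Types f g : T -> \bar R.

(** The integral of a nonnegative function is the supremum of the integrals of the
    simple functions below it, whether or not the function is measurable. *)
Lemma le_integral_nonmeasurable f g : (forall x, (0 <= f x)%E) ->
  (forall x, (f x <= g x)%E) -> (\int[P]_x f x <= \int[P]_x g x)%E.
Proof.
move=> f0 fg; have g0 x : (0 <= g x)%E by exact: le_trans (fg x).
rewrite !ge0_integralTE//; apply: ge_ereal_sup => _ [h /= hf <-].
by apply: ereal_sup_ubound; exists h => //= x; exact: le_trans (hf x) _.
Qed.

Lemma ae_le_integral_of_measurable f g : measurable_fun setT f ->
  (forall x, (0 <= f x)%E) -> (forall x, (0 <= g x)%E) ->
  {ae P, forall x, (f x <= g x)%E} -> (\int[P]_x f x <= \int[P]_x g x)%E.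
Proof.
move=> mf f0 g0 [N [mN N0 fgN]].
pose f' := f \_ (~` N).
have mf' : measurable_fun setT f'.
  by apply/(measurable_restrictT _ _).1; [exact: measurableC|exact: measurable_funTS].
have f'0 x : (0 <= f' x)%E by rewrite /f' patchE; case: ifP.
have -> : (\int[P]_x f x = \int[P]_x f' x)%E.
  apply: ge0_ae_eq_integral => //; exists N; split => // x /= h.
  by apply: contrapT => Nx; apply: h => _; rewrite /f' patchE mem_set.
apply: le_integral_nonmeasurable => // x; rewrite /f' patchE.
case: ifPn => // /set_mem /= nNx.
by apply: contrapT => /negP fg; apply: nNx; apply: fgN => /= h; rewrite h in fg.
Qed.

Lemma ae_integral_le_cst f (c : R) : 0 <= c -> (forall x, (0 <= f x)%E) ->
  {ae P, forall x, (f x <= c%:E)%E} -> (\int[P]_x f x <= c%:E)%E.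
Proof.
move=> c0 f0 [N [mN N0 fN]].
pose g x : \bar R := if x \in N then +oo%E else c%:E.
have mg : measurable_fun setT g.
  by apply: measurable_fun_ifT => //; apply: (measurable_fun_bool true);
    rewrite setTI (_ : _ @^-1` _ = N)//; apply/seteqP; split => x /=; [exact: set_mem|exact: mem_set].
have -> : (c%:E = \int[P]_x g x)%E.
  transitivity (\int[P]_x (cst c%:E) x)%E.
    by rewrite integral_cst// [X in (_ * X)%E]probability_setT mule1.
  apply: ge0_ae_eq_integral => //; first by move=> x _; rewrite /g; case: ifP.
  exists N; split => // x /= h; apply: contrapT => Nx; apply: h => _.
  by rewrite /g memNset.
apply: le_integral_nonmeasurable => // x; rewrite /g; case: ifPn => [_|/negP]; first exact: leey.
by rewrite inE => nNx; apply: contrapT => fx; apply: nNx; apply: fN.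
Qed.
End lower_integral.

(** * The long-run cost of deletions *)

Section flips.
Context d (T : measurableType d) (R : realType) (P : probability T R).
Variables (q : R) (b : T -> nat -> bool).
Hypotheses (q_half : 1 < 2 * q) (q1 : q <= 1) (cb : coin_flips P q b).
Notation prefix := (prefix b).
Let del := 2 * q - 1.
Let del0 : 0 < del. Proof. by rewrite /del subr_gt0. Qed.
Let q01 : 0 <= q <= 1. Proof. by move: q_half q1 => h1 h2; apply/andP; split; lra. Qed.

Lemma tokens_rate : {ae P, forall w, (fun n => (tokens (prefix w n))%:R / n%:R : R) @ \oo --> 1 - q}.
Proof.
have hq := q_half; have hq1 := q1.
apply: (strong_law cb (g := tokens) (C := 1)) => //.
- by rewrite subr_ge0.
- by move=> s a; rewrite /tokens -cats1 count_cat leq_addr.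
- move=> n; rewrite mean_tokens_sq; apply: ler_wpM2r => //; nra.
Qed.

Lemma backlog_rcons s a : (backlog s <= backlog (rcons s a))%N.
Proof. by elim: s => [//|c s IH] /=; case: c => //; lia. Qed.

Lemma total_backlog_rcons s a : (total_backlog s <= total_backlog (rcons s a))%N.
Proof. by elim: s => [//|c s IH] /=; have := backlog_rcons s a; lia. Qed.

Lemma total_backlog_rate :
  {ae P, forall w, (fun n => (total_backlog (prefix w n))%:R / n%:R : R) @ \oo --> (1 - q) / del}.
Proof.
have C0 : 0 <= 3 * (2 * drift_bound q + 1) / del ^+ 2.
  apply: divr_ge0; last exact: sqr_ge0.
  apply: mulr_ge0 => //; apply: addr_ge0 => //; apply: mulr_ge0 => //.
  by rewrite /drift_bound addr_ge0// divr_ge0// sqr_ge0.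
apply: (strong_law cb (g := total_backlog) (C := 3 * (2 * drift_bound q + 1) / del ^+ 2)) => //.
- by rewrite divr_ge0 ?subr_ge0// ltW.
- exact: total_backlog_rcons.
- exact: mean_total_backlog_sq.
Qed.

(** The constraints of the linear program on the queue lengths [V] and the deleted
    slots [dl]; inequalities, because tokens may be wasted. *)
Definition deleted_path (a : nat -> bool) (V : nat -> nat) (dl : nat -> bool) :=
  V 0%N = 0%N /\ forall k, if a k then ((V k).+1 <= V k.+1 + dl k.+1)%N
                           else (V k <= (V k.+1 + dl k.+1).+1)%N.

Let late_rate nu w n : \bar R := (late q nu (prefix w n) / n%:R)%:E.

(** [deletion_lower_bound] divided by [n].  The late backlog enters through its
    lower limit, whose mean Fatou's lemma bounds. *)
Lemma path_lower_bound nu (K : R) w V dl : (0 < nu)%N ->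
  deleted_path (b w) V dl ->
  (limsup_avg R (fun n => \sum_(k < n) dl k.+1)%N <= K%:E)%E ->
  (fun n => (tokens (prefix w n))%:R / n%:R : R) @ \oo --> 1 - q ->
  (fun n => (total_backlog (prefix w n))%:R / n%:R : R) @ \oo --> (1 - q) / del ->
  (((1 - q) / del + nu%:R * (del - K))%:E - limn_einf (late_rate nu w) <=
   limsup_avg R (fun n => \sum_(1 <= k < n.+1) V k)%N)%E.
Proof.
move=> nu0 [V0 step] limD limT limB; set c0 : R := (1 - q) / del + nu%:R * (del - K).
set L := limn_einf _; set A := limsup_avg _ _.
have A0 : (0 <= A)%E by apply: limn_esup_ge0 => n; rewrite lee_fin divr_ge0.
rewrite leNgt; apply/negP => AL.
have L0 : (0 <= L)%E.
  by apply: limn_einf_ge; apply: nearW => n; rewrite lee_fin divr_ge0// late_ge0.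
have [l Ll] : exists l : R, L = l%:E.
  by case: L L0 AL => [l _ _|_|//]; [exists l|rewrite addeNy// ltNge leNye].
have [a Aa] : exists a : R, A = a%:E.
  by case: A A0 AL => [a _ _|_|//]; [exists a|rewrite Ll ltNge leey].
rewrite Ll Aa -EFinB lte_fin in AL.
pose e := (c0 - l - a) / (4 + 3 * nu%:R).
have n1 : 1 <= nu%:R :> R by rewrite ler1n.
have e0 : 0 < e by apply: divr_gt0; lra.
have eE : e * (4 + 3 * nu%:R) = c0 - l - a by rewrite /e mulfVK// gt_eqF//; lra.
have nearA : \forall n \near \oo, (\sum_(1 <= k < n.+1) V k)%N%:R / n%:R < a + e.
  have : (A < (a + e)%:E)%E by rewrite Aa lte_fin ltrDl.
  by move/limn_esup_lt; apply: filterS => n; rewrite lte_fin.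
have nearD : \forall n \near \oo, (\sum_(k < n) dl k.+1)%N%:R / n%:R < K + e.
  have : (limsup_avg R (fun n => \sum_(k < n) dl k.+1)%N < (K + e)%:E)%E.
    by apply: le_lt_trans limD _; rewrite lte_fin ltrDl.
  by move/limn_esup_lt; apply: filterS => n; rewrite lte_fin.
have nearT : \forall n \near \oo, `|1 - q - (tokens (prefix w n))%:R / n%:R| <= e.
  by move/cvgrPdist_le: limT; apply.
have nearB : \forall n \near \oo, `|(1 - q) / del - (total_backlog (prefix w n))%:R / n%:R| <= e.
  by move/cvgrPdist_le: limB; apply.
have nearn : \forall n \near \oo, (nu * nu)%:R / e <= n%:R :> R by exact: nbhs_infty_ger.
suff : ((l + e)%:E <= L)%E by rewrite Ll lee_fin; lra.
apply: limn_einf_ge.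
near=> n.
have n0 : 0 < n%:R :> R.
  have : (0 < n)%N by near: n; exact: nbhs_infty_gt.
  by rewrite ltr0n.
have hA : (\sum_(1 <= k < n.+1) V k)%N%:R / n%:R < a + e by near: n.
have hD : (\sum_(k < n) dl k.+1)%N%:R / n%:R < K + e by near: n.
have hT : `|1 - q - (tokens (prefix w n))%:R / n%:R| <= e by near: n.
have hB : `|(1 - q) / del - (total_backlog (prefix w n))%:R / n%:R| <= e by near: n.
have hn : (nu * nu)%:R / e <= n%:R :> R by near: n.
rewrite /late_rate lee_fin.
have step' k : (k < size (prefix w n))%N -> if nth false (prefix w n) k
    then ((V k).+1 <= V k.+1 + dl k.+1)%N else (V k <= (V k.+1 + dl k.+1).+1)%N.
  by rewrite size_prefix => kn; rewrite nth_mkseq.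
have := deletion_lower_bound q_half q1 nu0 V0 step'.
rewrite size_prefix.
have -> : surplus (prefix w n) = n%:R - 2 * (tokens (prefix w n))%:R :> R.
  have sz : (count id (prefix w n) + count negb (prefix w n) = n)%N.
    by rewrite -[RHS](size_prefix b w n) -(count_predC id).
  by rewrite /surplus /tokens -{3}sz natrD; ring.
rewrite big_add1 /= big_mkord in hA.
move: hA hD hT hB; rewrite !ler_norml => hA hD /andP[hT _] /andP[_ hB].
move: hA hD hT hB hn; set SV := (\sum_(k < n) V _)%N%:R; set D := (\sum_(k < n) dl _)%N%:R.
move: (tokens _)%:R (total_backlog _)%:R (late _ _ _) (n%:R) n0 => t B lt x x0.
have frac (y z : R) : y / x <= z -> y <= z * x by rewrite ler_pdivrMr.
have frac' (y z : R) : z <= y / x -> z * x <= y by rewrite ler_pdivlMr.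
move=> /ltW/frac hA /ltW/frac hD hT hB.
rewrite ler_pdivrMr// => hn.
have {}hT : t <= (1 - q + e) * x by apply: frac; lra.
have {}hB : ((1 - q) / del - e) * x <= B by apply: frac'; lra.
rewrite ler_pdivlMr// => H.
have hnu : nu%:R * ((x - 2 * ((1 - q + e) * x)) - (K + e) * x) <= nu%:R * (x - 2 * t - D).
  by apply: ler_wpM2l => //; lra.
have {}eE : e * (4 + 3 * nu%:R) * x = (c0 - l - a) * x by rewrite eE.
rewrite /c0 /del in eE hB *.
move: ((1 - q) / _) eE hB => rho eE hB; lra.
Unshelve. all: by end_near. Qed.

Let int_late_rate nu : (0 < nu)%N ->
  measurable_fun setT (fun w => limn_einf (late_rate nu w)) /\
  (\int[P]_w limn_einf (late_rate nu w) <= (6 * drift_bound q / (del ^+ 2 * nu%:R))%:E)%E.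
Proof.
move=> nu0.
have mlate n : measurable_fun setT (late_rate nu ^~ n).
  apply/measurable_EFinP; apply: measurable_funM => //.
  exact: (measurable_prefix_fun cb (late q nu)).
have late0 n w : (0 <= late_rate nu w n)%E by rewrite lee_fin divr_ge0// late_ge0.
split.
  rewrite /limn_einf; apply: measurableT_comp; first exact: oppe_measurable.
  by apply: measurable_fun_limn_esup => n; exact: measurableT_comp.
have := @fatou _ _ R P setT measurableT (fun n w => late_rate nu w n) mlate (fun n w _ => late0 n w).
move/le_trans; apply; apply: limn_einf_le => n.
rewrite (_ : (\int[P]_w _)%E = (mean q n (fun s => n%:R^-1 * late q nu s))%:E); last first.
  rewrite -(integral_prefix cb); last by move=> s; rewrite mulr_ge0// late_ge0.
  by apply: eq_integral => w _; rewrite /late_rate mulrC.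
rewrite lee_fin meanZ; have [->|n0] := posnP n.
  rewrite invr0 mul0r; apply: divr_ge0; last by apply: mulr_ge0 => //; exact: sqr_ge0.
  by apply: mulr_ge0 => //; rewrite /drift_bound addr_ge0// divr_ge0// sqr_ge0.
rewrite mulrC ler_pdivrMr ?ltr0n//; exact: mean_late.
Qed.

(** The path bound is almost surely a measurable minorant of [F], cut off at 0 to
    stay within nonnegative integrals. *)
Lemma cost_lower_bound nu (K : R) (F : T -> \bar R) : (0 < nu)%N ->
  (forall w, (0 <= F w)%E) ->
  {ae P, forall w, exists V dl, [/\ deleted_path (b w) V dl,
     (limsup_avg R (fun n => \sum_(k < n) dl k.+1)%N <= K%:E)%E &
     F w = limsup_avg R (fun n => \sum_(1 <= k < n.+1) V k)%N]} ->
  (((1 - q) / del + nu%:R * (del - K) - 6 * drift_bound q / (del ^+ 2 * nu%:R))%:E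
     <= \int[P]_w F w)%E.
Proof.
move=> nu0 F0 FV; have [mL intL] := int_late_rate nu0.
set c0 : R := (1 - q) / del + nu%:R * (del - K).
pose L w := limn_einf (late_rate nu w).
have L0 w : (0 <= L w)%E.
  by apply: limn_einf_ge; apply: nearW => n; rewrite lee_fin divr_ge0// late_ge0.
pose G w := maxe (c0%:E - L w)%E 0%E.
have mG : measurable_fun setT G.
  apply: measurable_maxe; last exact: measurable_cst.
  by apply: emeasurable_funB => //; exact: measurable_cst.
have G0 w : (0 <= G w)%E by rewrite le_max lexx orbT.
have GF : (\int[P]_w G w <= \int[P]_w F w)%E.
  apply: ae_le_integral_of_measurable => //.
  apply: filterS3 FV tokens_rate total_backlog_rate => w [V [dl [pV KD ->]]] tw bw.
  rewrite ge_max (path_lower_bound nu0 pV KD tw bw) /=.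
  by apply: limn_esup_ge0 => n; rewrite lee_fin divr_ge0.
have : (c0%:E <= \int[P]_w G w + \int[P]_w L w)%E.
  have [c00|c00] := leP c0 0.
    by apply: (@le_trans _ _ 0%E); [rewrite lee_fin|apply: adde_ge0; exact: integral_ge0].
  rewrite -ge0_integralD//.
  have -> : (c0%:E = \int[P]_w (cst c0%:E) w)%E.
    by rewrite integral_cst// [X in (_ * X)%E]probability_setT mule1.
  apply: ge0_le_integral => //.
  - by move=> w _; rewrite lee_fin ltW.
  - exact: emeasurable_funD.
  - move=> w _; rewrite /= /G; move: (L0 w); case: (L w) => [l _| _|//].
      by rewrite -EFinB -EFin_max -EFinD lee_fin -lerBlDr le_max lexx.
    by rewrite addey ?leey// gt_eqF// (@lt_le_trans _ _ 0%E)// ?ltNy0// le_max lexx orbT.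
move=> h; rewrite EFinB leeBlDr//; apply: le_trans h _; exact: leeD.
Qed.
End flips.

(** * Deletion maps *)

Definition driven_by (a : nat -> bool) (Q : nat -> nat) :=
  Q 0%N = 0%N /\ forall k, Q k.+1 = if a k then (Q k).+1 else (Q k).-1.

Lemma eventual_limit (u : nat -> nat) (I v : nat) :
  (forall i, (I <= i)%N -> u i = v) -> lim (u i @[i --> \oo]) = v.
Proof.
move=> h; apply: (lim_near_cst (@discrete_hausdorff nat)); by exists I.
Qed.

Section deletion.
Variables (a : nat -> bool) (Q : nat -> nat) (M : deletion_seq).
Hypothesis aQ : driven_by a Q.
Hypothesis M_inj : forall i j m, M i = Some m -> M j = Some m -> i = j.

Let done i n : bool := has (fun j => M j == Some n) (iota 0 i).

Let done_last i n : done i.+1 n = done i n || (M i == Some n).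
Proof. by rewrite /done -addn1 iotaD has_cat /= orbF. Qed.

Let done_new i n : M i = Some n -> done i n = false.
Proof.
move=> Mi; apply/negP => /hasP[j]; rewrite mem_iota add0n => /andP[_ ji] /eqP Mj.
by have := M_inj Mi Mj; move: ji => /[swap] ->; rewrite ltnn.
Qed.

Lemma point_deletion_le (P : nat -> nat) m n : (point_deletion P m n <= P n)%N.
Proof. by rewrite /point_deletion; case: ifP => // _; exact: leq_pred. Qed.

(** A point deletion lowers a path by one on an interval that starts at the deleted
    slot and ends where the path reaches 0.  Only the start can break the
    constraints between consecutive queue lengths; at the end the path cannot go
    any lower. *)
Lemma delete_first_step i : delete_first Q M i 0%N = 0%N /\ forall k,
  if a k then ((delete_first Q M i k).+1 <= delete_first Q M i k.+1 + done i k.+1)%N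
  else (delete_first Q M i k <= (delete_first Q M i k.+1 + done i k.+1).+1)%N.
Proof.
elim: i => [|i [P0 IH]] /=.
  case: aQ => Q0 QS; split => // k; rewrite QS; case: (a k); rewrite addn0 ?ltnS ?leqSpred//.
case Mi: (M i) => [m|]; last first.
  split => // k; rewrite done_last Mi orbF; exact: IH.
set P := delete_first Q M i in P0 IH *.
split; first by rewrite /point_deletion P0; case: ifP.
move=> k; have IHk := IH k; rewrite done_last Mi.
have -> : (done i k.+1 || (Some m == Some k.+1) = (done i k.+1 + (m == k.+1))%N :> nat).
  rewrite -[Some m == _]/(m == k.+1); case: (m =P k.+1) => [mk|_]; last by rewrite orbF addn0.
  by rewrite done_new ?Mi ?mk.
rewrite /point_deletion.
have rangeS : (m <= k)%N -> index_iota m k.+2 = rcons (index_iota m k.+1) k.+1.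
  by move=> mk; rewrite /index_iota subSn ?leqW// -addn1 iotaD /= subnKC ?leqW// cats1.
have [mk|km] := leqP m k.
  rewrite rangeS// all_rcons (leqW mk) (@ltn_eqF m k.+1 mk) addn0 andTb.
  have Pk : all (fun t => (0 < P t)%N) (index_iota m k.+1) -> (0 < P k)%N.
    by move/allP; apply; rewrite mem_index_iota mk ltnSn.
  move: IHk Pk; move: (all _ _) (done i k.+1) (P k) (P k.+1) (a k).
  by clear=> b d x y [] + + /=; case: b => [|h _]; rewrite ?andbT ?andbF//= => + /(_ isT); case: y => [|y] /=; lia.
have [->|mk] := eqVneq m k.+1.
  rewrite leqnn !(andTb, andFb); move: IHk.
  move: (all _ _) (done i k.+1) (P k) (P k.+1) (a k).
  by clear=> b d x y [] /=; case: b; case: y => [|y] /=; lia.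
have -> : (m <= k.+1)%N = false by lia.
by rewrite !andFb addn0.
Qed.

Lemma delete_first_le i j n : (i <= j)%N -> (delete_first Q M j n <= delete_first Q M i n)%N.
Proof.
move=> ij; rewrite -(subnKC ij); elim: (j - i)%N => [|k IH]; rewrite ?addn0 ?addnS//=.
apply: leq_trans IH; case: (M _) => // m; exact: point_deletion_le.
Qed.

(** A nonincreasing sequence of natural numbers reaches its limit. *)
Lemma multi_deletion_reached n :
  exists I, forall i, (I <= i)%N -> delete_first Q M i n = multi_deletion Q M n.
Proof.
suff [I [v hI]] : exists I v, forall i, (I <= i)%N -> delete_first Q M i n = v.
  by exists I => i Ii; rewrite /multi_deletion (eventual_limit hI) hI.
have exv : exists v, `[< exists i, delete_first Q M i n = v >].
  by exists (delete_first Q M 0 n); apply/asboolP; exists 0%N.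
case: (ex_minnP exv) => v /asboolP[I Iv] vmin; exists I, v => i Ii.
apply/eqP; rewrite eqn_leq -{1}Iv delete_first_le//=.
by apply: vmin; apply/asboolP; exists i.
Qed.

Lemma deleted_path_multi :
  deleted_path a (multi_deletion Q M) (fun n => `[< deleted M n >]).
Proof.
have done_le i n : (done i n <= `[< deleted M n >])%N.
  case D: (done i n) => //; suff -> : `[< deleted M n >] by [].
  by move/hasP: D => [j _ /eqP Mj]; apply/asboolP; exists j.
split.
  by have [I hI] := multi_deletion_reached 0; rewrite -(hI I)//; case: (delete_first_step I).
move=> k; have [I hI] := multi_deletion_reached k; have [J hJ] := multi_deletion_reached k.+1.
have [_ /(_ k)] := delete_first_step (maxn I J).
rewrite hI ?leq_maxl// hJ ?leq_maxr//; have := done_le (maxn I J) k.+1.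
case: (a k); lia.
Qed.

Lemma num_deletedE n : num_deleted M n = (\sum_(k < n) `[< deleted M k.+1 >])%N.
Proof.
elim: n => [|n IH]; first by rewrite big_ord0.
by rewrite big_ord_recr -IH /num_deleted -{1}(addn1 n) iotaD count_cat /= addn0 add1n.
Qed.

End deletion.

(** * No job left behind along one path *)

Section nob.
Context (R : realType).
Variables (a : nat -> bool) (Q : nat -> nat).
Hypothesis aQ : driven_by a Q.

Definition is_left n : bool := `[< left_behind R Q n >].
Definition nob_seq : deletion_seq := fun n => if is_left n then Some n else None.

Lemma nob_seq_inj i j m : nob_seq i = Some m -> nob_seq j = Some m -> i = j.
Proof. by rewrite /nob_seq; case: (is_left i) => // -[->]; case: (is_left j) => // -[->]. Qed.

Lemma nob_deletedE n : deleted nob_seq n <-> left_behind R Q n.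
Proof.
split; first by move=> [i]; rewrite /nob_seq; case E: (is_left i) => // -[<-]; exact: asboolW E.
by move=> h; exists n; rewrite /nob_seq /is_left (asboolT h).
Qed.

Lemma left_behindP n : left_behind R Q n <->
  [/\ (0 < n)%N, (Q n.-1 < Q n)%N & forall j, (1 <= j)%N -> (Q (n + j)%N).+1 <> Q n].
Proof.
rewrite /left_behind /= /first_descent; split.
  move=> [[n0 Qn] /ereal_inf_pinfty h]; split => // j j1 Qj.
  by have := h (j%:R)%:E (ex_intro2 _ _ j (conj j1 Qj) erefl).
move=> [n0 Qn h]; split => //; apply/ereal_inf_pinfty => y -[j [j1 Qj] _].
by case: (h j j1 Qj).
Qed.

Let QS k : Q k.+1 = if a k then (Q k).+1 else (Q k).-1. Proof. by case: aQ. Qed.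

Lemma left_behind_min n j : left_behind R Q n -> (n <= j)%N -> (Q n <= Q j)%N.
Proof.
move=> /left_behindP[n0 Qn h] nj; rewrite -(subnKC nj); elim: (j - n)%N => [|k IH].
  by rewrite addn0.
rewrite addnS; have := h k.+1 isT; rewrite addnS QS; case: (a _); lia.
Qed.

Definition num_left n := (\sum_(k < n) is_left k.+1)%N.

Let num_leftS n : num_left n.+1 = (num_left n + is_left n.+1)%N. Proof. exact: big_ord_recr. Qed.

Let left_arrival n : is_left n.+1 -> Q n.+1 = (Q n).+1.
Proof. by move/asboolP/left_behindP => [_ /=]; rewrite QS; case: (a n); lia. Qed.

(** The jobs left behind up to slot [n] number exactly the minimum of the queue
    length from [n] on.  Each of them raises this minimum by one: it is an arrival
    below whose level the queue never returns. *)
Lemma num_left_le n j : (n <= j)%N -> (num_left n <= Q j)%N.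
Proof.
elim: n j => [|n IH] j nj; first by rewrite /num_left big_ord0.
rewrite num_leftS; case E: (is_left n.+1); last by rewrite addn0; exact: IH (ltnW nj).
have := left_behind_min (asboolW E) nj; rewrite (left_arrival E).
have := IH n (leqnn n); lia.
Qed.

(** If the arrival in slot [n.+1] is not left behind, the queue returns to its
    previous length, where the minimum is still to be found. *)
Lemma num_left_reached n : exists2 j, (n <= j)%N & (Q j <= num_left n)%N.
Proof.
elim: n => [|n [j nj Qj]]; first by exists 0%N => //; case: aQ => ->.
rewrite num_leftS; move: nj; rewrite leq_eqVlt => /orP[/eqP nj|nj]; last by exists j => //; lia.
rewrite -nj in Qj; case E: (is_left n.+1).
  by exists n.+1 => //; rewrite left_arrival//; lia.
have [an|an] := boolP (a n); last by exists n.+1 => //; rewrite QS (negbTE an); lia.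
have [i i1 Qi] : exists2 i, (1 <= i)%N & (Q (n.+1 + i)%N).+1 = Q n.+1.
  apply: contrapT => hn; move: E => /asboolP; apply; apply/left_behindP; split => //=.
    by rewrite QS an.
  by move=> i i1 Qi; apply: hn; exists i.
exists (n.+1 + i)%N; first by lia.
by move: Qi; rewrite (QS n) an; lia.
Qed.

(** The slots are processed in increasing order, and an arrival left behind keeps
    the queue positive for ever, so each of its deletions lowers the whole future. *)
Lemma delete_first_nob i n : delete_first Q nob_seq i n = (Q n - num_left (minn n i.-1))%N.
Proof.
elim: i n => [|i IH] n; first by rewrite minn0 /num_left big_ord0 subn0.
rewrite /= /nob_seq; case E: (is_left i); last first.
  rewrite -/nob_seq IH; case: i E {IH} => [//|i] E /=.
  have [ni|ni] := leqP n i; first by rewrite (minn_idPl _)// ?leqW// (minn_idPl _)//; lia.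
  by rewrite (minn_idPr _) ?(minn_idPr _) ?num_leftS ?E ?addn0//; lia.
rewrite -/nob_seq; case: i E IH => [|i] E IH.
  by move: E => /asboolP/left_behindP[].
rewrite /point_deletion.
have [ni|ni] := ltnP n i.+1.
  by rewrite andFb IH /=; congr (_ - num_left _)%N; lia.
rewrite (_ : all _ _); last first.
  apply/allP => t; rewrite mem_index_iota => /andP[it _].
  rewrite IH /= (minn_idPr _); last by lia.
  have := left_behind_min (asboolW E) it; rewrite (left_arrival E).
  have := num_left_le (leqnn i); lia.
rewrite IH /= (minn_idPr _) ?(minn_idPr _) ?num_leftS ?E; lia.
Qed.

Lemma multi_deletion_nob n : multi_deletion Q nob_seq n = (Q n - num_left n)%N.
Proof.
apply: (@eventual_limit _ n.+1) => i ni; rewrite delete_first_nob (minn_idPl _)//; lia.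
Qed.

Lemma nob_num_deleted n : num_deleted nob_seq n = num_left n.
Proof.
rewrite num_deletedE; apply: eq_bigr => k _; congr (nat_of_bool _).
by apply/asboolP/asboolP => /nob_deletedE.
Qed.

Lemma surplus_ge n j : (n <= j)%N ->
  (Q n + count id (drop n (mkseq a j)) <= Q j + count negb (drop n (mkseq a j)))%N.
Proof.
move=> nj; rewrite -(subnKC nj); elim: (j - n)%N => [|k IH].
  by rewrite addn0 drop_oversize ?size_mkseq//.
rewrite addnS mkseqS -cats1 drop_cat size_mkseq; case: ltnP => h; last first.
  have k0 : k = 0%N by lia.
  by rewrite k0 addn0 subnn /= QS; case: (a n) => /=; lia.
rewrite !count_cat /= QS; move: IH; case: (a _) => /=; lia.
Qed.

Lemma backlog_ge u t : (count negb u <= count id u + backlog (u ++ t))%N.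
Proof. by elim: u => [//|c u IH] /=; case: c => /=; lia. Qed.

(** The queue length in excess of its future minimum is at most the largest excess
    of tokens over arrivals ahead.  The surplus of arrivals over tokens never returns
    below its value at [N] after [M], so that the bits up to [M] suffice. *)
Lemma nob_le_backlog N M n : (n <= N <= M)%N ->
  (forall j, (M <= j)%N -> (N + 2 * tokens (mkseq a j) <= j + 2 * tokens (mkseq a N))%N) ->
  (multi_deletion Q nob_seq n <= backlog (drop n (mkseq a M)))%N.
Proof.
move=> /andP[nN NM] far; rewrite multi_deletion_nob.
have drop_split j : (n <= j)%N -> (j <= M)%N -> exists t, drop n (mkseq a M) = drop n (mkseq a j) ++ t.
  move=> nj jM; exists (drop j (mkseq a M)).
  have e : mkseq a j = take j (mkseq a M).
    by rewrite -(subnKC jM) /mkseq iotaD map_cat take_size_cat// size_map size_iota.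
  rewrite e -{1}(cat_take_drop j (mkseq a M)) drop_cat size_takel ?size_mkseq//; case: ltnP => // jn.
  have -> : n = j by lia.
  by rewrite subnn drop0 [drop j (take j _)]drop_oversize ?size_takel ?size_mkseq.
have tot j : (n <= j)%N -> (count id (drop n (mkseq a j)) + count negb (drop n (mkseq a j)) = j - n)%N.
  by move=> nj; rewrite (count_predC id) size_drop size_mkseq.
have tok j : (n <= j)%N -> tokens (mkseq a j) = (tokens (take n (mkseq a j)) + count negb (drop n (mkseq a j)))%N.
  by move=> nj; rewrite -{1}(cat_take_drop n (mkseq a j)) /tokens count_cat.
have tk j : (n <= j)%N -> take n (mkseq a j) = mkseq a n.
  by move=> nj; rewrite -(subnKC nj) /mkseq iotaD map_cat take_size_cat// size_map size_iota.
have [j nj Qj] := num_left_reached n; have := surplus_ge nj.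
have [jM|Mj] := leqP j M.
  have [t ->] := drop_split j nj jM; have := backlog_ge (drop n (mkseq a j)) t; lia.
have [t ->] := drop_split N nN NM; have := backlog_ge (drop n (mkseq a N)) t.
have := far j (ltnW Mj); rewrite (tok j)// (tok N)// !tk//.
have := tot j nj; have := tot N nN; lia.
Qed.

Lemma nob_sum_le N M : (N <= M)%N ->
  (forall j, (M <= j)%N -> (N + 2 * tokens (mkseq a j) <= j + 2 * tokens (mkseq a N))%N) ->
  (\sum_(1 <= k < N.+1) multi_deletion Q nob_seq k <= total_backlog (mkseq a M))%N.
Proof.
move=> NM far; rewrite total_backlogE size_mkseq.
rewrite -(big_mkord xpredT (fun k => backlog (drop k.+1 (mkseq a M)))) (big_cat_nat _ NM)//=.
rewrite big_add1 /=; apply: leq_trans (leq_addr _ _).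
rewrite !big_mkord; apply: leq_sum => k _; apply: (nob_le_backlog (N := N)) => //.
by rewrite ltn_ord.
Qed.

(** The reflection formula, with [k] the last slot whose token was wasted. *)
Lemma queue_le_surplus n : exists2 k, (k <= n)%N &
  (Q n + 2 * tokens (mkseq a n) + k = n + 2 * tokens (mkseq a k))%N.
Proof.
elim: n => [|n [k kn e]]; first by exists 0%N => //; case: aQ => ->.
have tS : tokens (mkseq a n.+1) = (tokens (mkseq a n) + ~~ a n)%N.
  by rewrite mkseqS /tokens -cats1 count_cat /= addn0.
case an: (a n); first by exists k; rewrite ?leqW// QS an tS an; lia.
case Qn: (Q n) => [|x].
  by exists n.+1 => //; rewrite QS an Qn; lia.
exists k; rewrite ?leqW// QS an tS an; lia.
Qed.
End nob.

(** * Long-run averages of no job left behind *)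

Lemma avg_near (R : realType) (u : nat -> nat) (l e : R) : 0 < e ->
  (fun n => (u n)%:R / n%:R : R) @ \oo --> l ->
  exists2 n0, (0 < n0)%N & forall n, (n0 <= n)%N ->
    (l - e) * n%:R <= (u n)%:R <= (l + e) * n%:R.
Proof.
move=> e0 /cvgrPdist_le /(_ e e0) [n0 _ h]; exists n0.+1 => // n nn.
have n0' : 0 < n%:R :> R by rewrite ltr0n; lia.
have := h n (ltnW nn); rewrite ler_norml => /andP[h1 h2].
have -> : (u n)%:R = (u n)%:R / n%:R * n%:R :> R by rewrite divfK ?gt_eqF.
by rewrite !ler_pM2r//; move: h1 h2; set v := (_ / _) => h1 h2; apply/andP; split; lra.
Qed.

Lemma limsup_avg_le (R : realType) (u : nat -> nat) (l : R) :
  (forall e, 0 < e -> exists n0, forall n, (n0 <= n)%N -> (u n)%:R <= (l + e) * n%:R) ->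
  (limsup_avg R u <= l%:E)%E.
Proof.
move=> h; apply/lee_addgt0Pr => e e0; rewrite -EFinD; have [n0 hn] := h e e0.
apply: limn_esup_le; exists n0.+1 => // n /= nn; rewrite lee_fin ler_pdivrMr; last by rewrite ltr0n; lia.
by apply: hn; lia.
Qed.

Section nob_limits.
Context (R : realType) (q : R) (a : nat -> bool) (Q : nat -> nat).
Hypothesis q_half : 1 < 2 * q.
Hypothesis q1 : q <= 1.
Hypothesis aQ : driven_by a Q.
Local Notation del := (2 * q - 1).
Hypothesis limT : (fun n => (tokens (mkseq a n))%:R / n%:R : R) @ \oo --> 1 - q.

(** The number of jobs left behind is at most the queue length, that is the surplus
    of the bits less its past minimum, and the latter grows sublinearly. *)
Lemma nob_density : (limsup_avg R (num_deleted (nob_seq R Q)) <= del%:E)%E.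
Proof.
have h1 := q_half; apply: limsup_avg_le => e e0.
have e4 : 0 < e / 4 by lra.
have [n0 n00 hn0] := avg_near e4 limT.
have [n1 hn1] : exists n1 : nat, n0%:R / (e / 2) <= n1%:R.
  by exists (Num.truncn (n0%:R / (e / 2))).+1; rewrite ltW// truncnS_gt.
exists (n0 + n1)%N => n nn; rewrite nob_num_deleted.
have nR : 0 <= n%:R :> R by [].
have n1n : n1%:R <= n%:R :> R by rewrite ler_nat; lia.
have n0n : n0%:R <= e / 2 * n%:R.
  have : n0%:R / (e / 2) <= n%:R by exact: le_trans hn1 n1n.
  by rewrite ler_pdivrMr ?[n%:R * _]mulrC//; lra.
apply: (@le_trans _ _ (Q n)%:R); first by rewrite ler_nat; exact: (num_left_le R aQ).
have [k kn /(congr1 (fun i => i%:R : R))] := queue_le_surplus aQ n.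
have /andP[tn _] := hn0 n (leq_trans (leq_addr _ _) nn).
rewrite !natrD => eQ.
have kR : 0 <= k%:R :> R by [].
have knR : k%:R <= n%:R :> R by rewrite ler_nat.
have tk0 : 0 <= (tokens (mkseq a k))%:R :> R by [].
have tk : (tokens (mkseq a k))%:R *+ 2 - k%:R <= e / 2 * n%:R.
  rewrite -mulr_natl; have [n0k|kn0] := leqP n0 k.
    have /andP[_ tk] := hn0 k n0k; nra.
  have : (tokens (mkseq a k))%:R <= k%:R :> R.
    by rewrite ler_nat -{2}(size_mkseq a k) /tokens count_size.
  have : k%:R <= n0%:R :> R by rewrite ler_nat ltnW.
  lra.
rewrite -mulr_natl in tk; nra.
Qed.

(** Looking ahead by a fraction [x] of [N] lets the surplus grow by about
    [del * x * N], more than the fluctuations [del * x / 6] of the token rate can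
    undo later; as [x] tends to 0 the additional backlogs are negligible. *)
Lemma nob_average : (fun n => (total_backlog (mkseq a n))%:R / n%:R : R) @ \oo --> (1 - q) / del ->
  (limsup_avg R (fun n => \sum_(1 <= k < n.+1) multi_deletion Q (nob_seq R Q) k)%N
     <= ((1 - q) / del)%:E)%E.
Proof.
have h1 := q_half; have h2 := q1; set rho := (1 - q) / del => limB.
have del0 : 0 < del by lra.
have rho0 : 0 <= rho by rewrite divr_ge0//; lra.
apply: limsup_avg_le => e e0.
have e2 : 0 < e / 2 by lra.
have [h hh] : exists h : nat, 4 * (rho + e / 2) / e <= h.+1%:R.
  by exists (Num.truncn (4 * (rho + e / 2) / e)); rewrite ltW// truncnS_gt.
(* The horizon [N] will be extended by a fraction of about [x]. *)
set x : R := h.+1%:R^-1.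
have x0 : 0 < x by rewrite invr_gt0.
have x1 : x <= 1 by rewrite invf_le1// ler1n.
have hx : h.+1%:R * x = 1 by rewrite mulfV.
have small : (rho + e / 2) * (2 * x) <= e / 2.
  have : 4 * (rho + e / 2) <= h.+1%:R * e by rewrite -ler_pdivrMr.
  move=> /(ler_wpM2r (ltW x0)); rewrite [h.+1%:R * e * x]mulrAC hx mul1r; lra.
have ep0 : 0 < del * x / 6 by rewrite divr_gt0// mulr_gt0.
have [n0 n00 hn0] := avg_near ep0 limT.
have [n1 n10 hn1] := avg_near e2 limB.
exists (n0 + n1 + h.+1)%N => N nN.
have n0N : (n0 <= N)%N by apply: leq_trans nN; rewrite -addnA leq_addr.
have n1N : (n1 <= N)%N by apply: leq_trans nN; rewrite addnAC leq_addl.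
have hN : (h.+1 <= N)%N := leq_trans (leq_addl _ _) nN.
set M := (N + (N %/ h.+1).+1)%N.
have NM : (N <= M)%N by exact: leq_addr.
have NR : 0 <= N%:R :> R by [].
have ML : N%:R * (1 + x) <= M%:R.
  have : (N * h.+1 + N <= M * h.+1)%N.
    by rewrite /M mulnDl leq_add2l ltnW// ltn_ceil.
  rewrite -(ler_nat R) natrD !natrM => /(ler_wpM2r (ltW x0)).
  by rewrite mulrDl -!mulrA hx !mulr1 mulrDr mulr1.
have MU : M%:R <= N%:R * (1 + 2 * x).
  have : (N %/ h.+1 * h.+1 <= N)%N by exact: leq_divM.
  rewrite -(ler_nat R) natrM => /(ler_wpM2r (ltW x0)); rewrite -mulrA hx mulr1 => hd.
  have : h.+1%:R <= N%:R :> R by rewrite ler_nat.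
  move=> /(ler_wpM2r (ltW x0)); rewrite hx => hxN.
  by rewrite /M natrD -[(_ %/ _).+1]addn1 natrD; lra.
have sN : (\sum_(1 <= k < N.+1) multi_deletion Q (nob_seq R Q) k <= total_backlog (mkseq a M))%N.
  apply: (nob_sum_le R aQ) => //.
  move=> j Mj; rewrite -(ler_nat R) !natrD.
  have /andP[_ tj] := hn0 j (leq_trans n0N (leq_trans NM Mj)).
  have /andP[tN _] := hn0 N n0N.
  have jR : N%:R * (1 + x) <= j%:R by apply: le_trans ML _; rewrite ler_nat.
  have c0 : 0 <= del - del * x / 3 by nra.
  have := ler_wpM2l c0 jR.
  have : (del + del * x / 3) * N%:R <= (del - del * x / 3) * (N%:R * (1 + x)).
    rewrite mulrCA mulrC; apply: ler_wpM2l => //.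
    have : 0 <= del * x * (1 - x) by rewrite !mulr_ge0//; lra.
    lra.
  lra.
have /andP[_ bM] := hn1 M (leq_trans n1N NM).
have re0 : 0 <= rho + e / 2 by lra.
apply: le_trans (_ : (total_backlog (mkseq a M))%:R <= _); first by rewrite ler_nat.
apply: le_trans bM _; apply: le_trans (ler_wpM2l re0 MU) _.
have := ler_wpM2r NR small; lra.
Qed.
End nob_limits.

(** * The information used by no job left behind *)

Lemma coin_flips_fst d d' (T : measurableType d) (T' : measurableType d') (R : realType)
    (P : probability T R) (P' : probability T' R) q b :
  coin_flips P q b -> coin_flips (P \x P')%E q (fun z => b z.1).
Proof.
have fstE (A : set T) : [set z : T * T' | A z.1] = A `*` setT.
  by apply/seteqP; split => z /=; [move=> ?; split|case].
move=> [mb lawb]; split => [n|s].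
  by rewrite (fstE [set w | b w n]); exact: measurableX.
rewrite (fstE [set w | mkseq (b w) (size s) = s]).
transitivity (P [set w | mkseq (b w) (size s) = s] * P' setT)%E.
  by apply: product_measure1E => //; exact: measurable_prefix.
by rewrite probability_setT mule1 lawb.
Qed.

Lemma nob_output (R : realType) (mdl : queue_model R)
    (z : outcome mdl * internal (no_job_left_behind R)) :
  policy_output z = nob_seq R (initial_path (model_path mdl z.1)).
Proof. by []. Qed.

Section filtration_oo.
Context (R : realType) (mdl : queue_model R).
Hypothesis xe : forall w, exists s v, epochs (model_path mdl w) s v.
Let G := \bigcup_(t in [set t : R | 0 <= t]) filtration mdl t.

Let sigma_path t c : 0 <= t -> <<s G >> [set w | model_path mdl w t = c].
Proof.
move=> t0.
rewrite (_ : [set w | model_path mdl w t = c] = \bigcup_(k in [set: nat])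
  [set w | (queue_length (model_path mdl w) t, model_path mdl w t) = (k, c)]).
  apply: sigma_bigcup => k _; apply: sub_sigma_algebra; exists t => //.
  apply: sub_sigma_algebra; exists t, (k, c); split => //=.
  by rewrite t0 lexx.
apply/seteqP; split => w /=.
  by move=> <-; exists (queue_length (model_path mdl w) t).
by move=> [k _ /= [_ ->]].
Qed.

Let Q n w := initial_path (model_path mdl w) n.

Let sigma_queue n (C : nat -> Prop) : <<s G >> [set w | C (Q n w)].
Proof.
elim: n C => [|n IH] C.
  have [c0|c0] := pselect (C 0%N).
    by rewrite (_ : [set w | _] = setT); [exact: sigma_setT|apply/seteqP; split].
  rewrite (_ : [set w | _] = set0); first exact: sigma_algebra0.
  by apply/seteqP; split.
pose B := [set w | arrival_bit (model_path mdl w) n].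
have GB : <<s G >> B by apply: sigma_arrival_bit; [exact: xe|exact: sigma_path].
rewrite (_ : [set w | _] = (B `&` [set w | C (Q n w).+1]) `|` (~` B `&` [set w | C (Q n w).-1])).
  apply: sigma_setU; apply: sigma_setI => //.
  - exact: (IH (fun k => C k.+1)).
  - exact: sigma_setC.
  - exact: (IH (fun k => C k.-1)).
apply/seteqP; split => w.
  rewrite /= /Q /= -/(arrival_bit _ _) => h.
  by case: ifPn h => b h; [left|right]; split => //; exact/negP.
rewrite /= /Q /= -/(arrival_bit _ _).
by move=> [[b h]|[b h]]; [rewrite ifT|rewrite ifF//; exact/negbTE/negP].
Qed.

Let sigma_queue2 i j (C : nat -> nat -> Prop) : <<s G >> [set w | C (Q i w) (Q j w)].
Proof.
rewrite (_ : [set w | _] = \bigcup_(v in [set: nat]) ([set w | Q i w = v] `&` [set w | C v (Q j w)])).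
  by apply: sigma_bigcup => v _; apply: sigma_setI; [exact: (sigma_queue i (fun k => k = v))|exact: sigma_queue].
by apply/seteqP; split => w /=; [move=> h; exists (Q i w)|move=> [v _ [<-]]].
Qed.

Lemma filtration_oo_left_behind n :
  filtration_oo mdl [set w | left_behind R (initial_path (model_path mdl w)) n].
Proof.
have [n0|n0] := posnP n.
  rewrite (_ : [set w | _] = set0); first exact: sigma_algebra0.
  by apply/seteqP; split => w //= -[[]]; rewrite n0.
rewrite (_ : [set w | _] = [set w | (Q n.-1 w < Q n w)%N] `&`
   ~` \bigcup_(j in [set j | 1 <= j]%N) [set w | (Q (n + j) w).+1 = Q n w]).
  apply: sigma_setI; first exact: (sigma_queue2 n.-1 n (fun u v => u < v)%N).
  apply: sigma_setC; apply: sigma_bigcup => j _.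
  exact: (sigma_queue2 (n + j) n (fun u v => u.+1 = v)).
apply/seteqP; split => w /=.
  move=> /left_behindP[_ h1 h2]; split => // -[j /= j1]; exact: h2.
move=> [h1 h2]; apply/left_behindP; split => // j j1 hj; apply: h2.
by exists j.
Qed.
End filtration_oo.

(** * Costs of policies *)

Section policies.
Context (R : realType) (p lam : R) (mdl : queue_model R).
Hypotheses (p01 : 0 < p < 1) (lam01 : 1 - p < lam < 1) (queue : is_queue p lam mdl).
Let q := lam / (lam + (1 - p)).
Local Notation del := (2 * q - 1).
Local Notation joint pi := (model_prob mdl \x internal_prob pi)%E.
Local Notation nob := (no_job_left_behind R).

Let lam0 : 0 < lam.
Proof. by move: p01 lam01 => /andP[_ h1] /andP[h2 _]; apply: lt_trans h2; rewrite subr_gt0. Qed.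

Let c0 : 0 < lam + (1 - p).
Proof. by move: p01 lam0 => /andP[_ h1] h2; lra. Qed.

Let q1 : q <= 1.
Proof. by rewrite ler_pdivrMr// mul1r; move: p01 => /andP[_ h1]; lra. Qed.

Lemma arrival_bias : 2 * q - 1 = (lam - (1 - p)) / (lam + (1 - p)).
Proof. by rewrite /q; field; rewrite gt_eqF. Qed.

Let q_half : 1 < 2 * q.
Proof.
by rewrite -subr_gt0 arrival_bias divr_gt0// subr_gt0; case/andP: lam01.
Qed.

Lemma optimal_backlog : (1 - q) / del = (1 - p) / (lam - (1 - p)).
Proof.
have d0 : lam - (1 - p) != 0 by rewrite subr_eq0 gt_eqF//; case/andP: lam01.
rewrite arrival_bias /q; field.
by rewrite d0 gt_eqF.
Qed.

Let flips (pi : policy R) : coin_flips (joint pi) q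
  (fun z : outcome mdl * internal pi => arrival_bit (model_path mdl z.1)).
Proof. exact: coin_flips_fst (queue_coin_flips p01 lam0 queue). Qed.

Let driven w : driven_by (arrival_bit (model_path mdl w)) (initial_path (model_path mdl w)).
Proof. by []. Qed.

Let limsup_avg_ge0 (u : nat -> nat) : (0 <= limsup_avg R u)%E.
Proof. by apply: limn_esup_ge0 => n; rewrite lee_fin divr_ge0. Qed.

(** [K] is the budget for an arbitrary feasible policy, and [del] for
    no-job-left-behind, whose exact cost requires the sharper rate. *)
Lemma policy_cost_ge (pi : policy R) (nu : nat) (K : R) : (0 < nu)%N ->
  {ae joint pi, forall z,
    (forall i j m, policy_output z i = Some m -> policy_output z j = Some m -> i = j) /\
    (limsup_avg R (num_deleted (policy_output z)) <= K%:E)%E} ->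
  (((1 - q) / del + nu%:R * (del - K) - 6 * drift_bound q / (del ^+ 2 * nu%:R))%:E
     <= cost mdl pi)%E.
Proof.
move=> nu0 hpi; apply: (cost_lower_bound q_half q1 (@flips pi) nu0) => //.
apply: filterS hpi => z [inj lim].
exists (multi_deletion (initial_path (model_path mdl z.1)) (policy_output z)).
exists (fun n => `[< deleted (policy_output z) n >]); split => //.
  exact: deleted_path_multi.
by rewrite (_ : (fun n => _) = num_deleted (policy_output z))//; apply/funext => n; rewrite num_deletedE.
Qed.

Let nob_limits : {ae joint nob, forall z,
  [/\ forall i j m, policy_output z i = Some m -> policy_output z j = Some m -> i = j,
      (limsup_avg R (num_deleted (policy_output z)) <= del%:E)%E &
      (limsup_avg R (fun n => \sum_(1 <= k < n.+1)
        multi_deletion (initial_path (model_path mdl z.1)) (policy_output z) k)%N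
        <= ((1 - q) / del)%:E)%E]}.
Proof.
apply: filterS2 (tokens_rate q_half q1 (@flips nob)) (total_backlog_rate q_half q1 (@flips nob)).
move=> z limT limB; rewrite nob_output; split.
- exact: nob_seq_inj.
- exact: nob_density q_half q1 (@driven _) limT.
- exact: nob_average q_half q1 (@driven _) limT limB.
Qed.

Lemma nob_feasible : feasible_policy p lam mdl nob.
Proof.
apply: filterS nob_limits => z [inj lim _]; split => //.
  by rewrite nob_output => n /nob_deletedE[].
apply: le_trans lim _; rewrite lee_fin arrival_bias addrA ler_pM2r ?invr_gt0 ?(addrA lam) //.
  by move: lam01 => /andP[_ h]; lra.
by rewrite -addrA.
Qed.

Lemma nob_cost : cost mdl nob = ((1 - p) / (lam - (1 - p)))%:E.
Proof.
have h1 := q_half; have h2 := q1; rewrite -optimal_backlog; apply/eqP; rewrite eq_le; apply/andP; split.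
  apply: ae_integral_le_cst.
  - by rewrite divr_ge0//; lra.
  - by move=> z; exact: limsup_avg_ge0.
  - by apply: filterS nob_limits => z [].
apply/lee_subgt0Pr => e e0; rewrite -EFinB.
set C := 6 * drift_bound q / del ^+ 2.
have [nu hnu] : exists nu : nat, C / e <= nu.+1%:R.
  by exists (Num.truncn (C / e)); rewrite ltW// truncnS_gt.
have h : {ae joint nob, forall z,
    (forall i j m, policy_output z i = Some m -> policy_output z j = Some m -> i = j) /\
    (limsup_avg R (num_deleted (policy_output z)) <= del%:E)%E}.
  by apply: filterS nob_limits => z [].
apply: le_trans (policy_cost_ge (ltn0Sn nu) h); rewrite lee_fin subrr mulr0 addr0.
rewrite lerD2l lerN2 invfM mulrA -/C ler_pdivrMr ?ltr0n// mulrC.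
by rewrite -ler_pdivrMr.
Qed.

Lemma nob_lookahead : lookahead_policy p lam mdl +oo%E nob.
Proof.
split; first exact: nob_feasible.
move=> n n0.
rewrite (_ : [set z : outcome mdl * internal nob | deleted (policy_output z) n] =
  [set w | left_behind R (initial_path (model_path mdl w)) n] `*` setT).
  apply: sub_sigma_algebra; exists [set w | left_behind R (initial_path (model_path mdl w)) n].
    exact: filtration_oo_left_behind (queue_epochs p01 lam0 queue) n.
  by exists setT.
apply/seteqP; split => z; first by move=> /(@nob_deletedE R _ n).1 h; split.
by move=> [h _]; exact: (@nob_deletedE R _ n).2.
Qed.

Lemma optimal_cost_le :
  (optimal_cost p lam mdl +oo <= ((1 - p) / (lam - (1 - p)))%:E)%E.
Proof.
rewrite -nob_cost; apply: ereal_inf_lbound; exists nob; split => //; exact: nob_lookahead.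
Qed.

Lemma optimal_cost_ge w (nu : nat) : (0 < nu)%N ->
  (((1 - p) / (lam - (1 - p)) - nu%:R * ((1 - lam) / (lam + (1 - p)))
     - 6 * drift_bound q / (del ^+ 2 * nu%:R))%:E <= optimal_cost p lam mdl w)%E.
Proof.
move=> nu0; apply: le_ereal_inf_tmp => _ [pi [[feas _] <-]].
have h : {ae joint pi, forall z,
    (forall i j m, policy_output z i = Some m -> policy_output z j = Some m -> i = j) /\
    (limsup_avg R (num_deleted (policy_output z)) <= (p / (lam + 1 - p))%:E)%E}.
  by apply: filterS feas => z [].
apply: le_trans (policy_cost_ge nu0 h); rewrite lee_fin optimal_backlog.
rewrite (_ : nu%:R * (del - p / (lam + 1 - p)) = - (nu%:R * ((1 - lam) / (lam + (1 - p)))))//.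
rewrite arrival_bias -(addrA lam 1) -mulrBl -mulrN -mulNr; congr (_ * (_ * _)); ring.
Qed.

End policies.

(** * Heavy traffic *)

Lemma cvge_near_cst (T : Type) (F : set_system T) (FF : ProperFilter F) (R : realType)
    (f : T -> \bar R) (c : R) :
  (forall e, 0 < e -> \forall x \near F, ((c - e)%:E <= f x <= (c + e)%:E)%E) ->
  f @ F --> c%:E.
Proof.
move=> h; apply/fine_cvgP; split.
  apply: filterS (h 1 ltr01) => x /andP[h1 h2].
  by rewrite fin_numElt (lt_le_trans _ h1) ?ltNyr//= (le_lt_trans h2) ?ltry.
apply/cvgrPdist_le => e e0; apply: filterS (h e e0) => x; rewrite /comp.
by case: (f x) => [r| |]; rewrite ?leye_eq ?leeNy_eq ?andbF// !lee_fin /= ler_distlC.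
Qed.

Lemma near_left1 (R : realType) (e : R) (P : R -> Prop) : 0 < e ->
  (forall lam, 1 - e < lam < 1 -> P lam) -> \forall lam \near (1 : R)^'-, P lam.
Proof.
move=> e0 h; have e1 : 1 - e < 1 by rewrite ltrBlDr ltrDl.
by apply: filterS2 (nbhs_left_gt e1) (nbhs_left_lt (1 : R)) => lam h1 h2; apply: h; rewrite h1.
Qed.

Section heavy_traffic.
Context (R : realType) (p : R).
Hypothesis p01 : 0 < p < 1.

Lemma optimal_backlog_near e : 0 < e -> exists2 d, 0 < d <= p &
  forall lam, 1 - d < lam < 1 ->
    (1 - p) / p <= (1 - p) / (lam - (1 - p)) <= (1 - p) / p + e.
Proof.
move=> e0; have [p0 p1] := andP p01.
have ep0 : 0 < e * p ^+ 2 / 2 by rewrite divr_gt0// mulr_gt0// exprn_gt0.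
exists (Num.min (p / 2) (e * p ^+ 2 / 2)).
  by rewrite lt_min ep0 ge_min divr_gt0//=; apply/orP; left; lra.
move=> lam /andP[]; rewrite ltrBlDr -ltrBlDl lt_min => /andP[l1 l2] l3.
have d0 : 0 < lam - (1 - p) by lra.
apply/andP; split; first by rewrite ler_pM2l ?subr_gt0// lef_pV2 ?posrE//; lra.
rewrite -subr_ge0.
have -> : (1 - p) / p + e - (1 - p) / (lam - (1 - p)) =
    (e * p * (lam - (1 - p)) - (1 - p) * (1 - lam)) / (p * (lam - (1 - p))).
  by field; rewrite !gt_eqF.
apply: divr_ge0; last by rewrite mulr_ge0// ltW.
have : e * p * (p / 2) <= e * p * (lam - (1 - p)).
  by apply: ler_wpM2l; [rewrite mulr_ge0// ltW|lra].
have : (1 - p) * (1 - lam) <= 1 * (1 - lam) by apply: ler_wpM2r; lra.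
lra.
Qed.

(** First [nu] is chosen to make the last term small uniformly in [lam], the drift
    being bounded away from 0 near [lam = 1]; then [lam] makes the first one small. *)
Lemma penalty_near e : 0 < e -> exists2 nu, (0 < nu)%N & exists2 d, 0 < d <= p &
  forall lam, 1 - d < lam < 1 ->
    nu%:R * ((1 - lam) / (lam + (1 - p))) +
    6 * drift_bound (lam / (lam + (1 - p))) / ((2 * (lam / (lam + (1 - p))) - 1) ^+ 2 * nu%:R) <= e.
Proof.
move=> e0; have [p0 p1] := andP p01.
set C := 6 * (1 + 28 * (4 / p) ^+ 2) * (4 / p) ^+ 2.
have [nu hnu] : exists nu : nat, C / (e / 2) <= nu.+1%:R.
  by exists (Num.truncn (C / (e / 2))); rewrite ltW// truncnS_gt.
have nu0 : 0 < nu.+1%:R :> R by [].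
exists nu.+1 => //; have ed0 : 0 < e / 2 / nu.+1%:R / 2 by rewrite !divr_gt0.
exists (Num.min (p / 2) (e / 2 / nu.+1%:R / 2)).
  by rewrite lt_min ed0 ge_min divr_gt0//=; apply/orP; left; lra.
move=> lam /andP[]; rewrite ltrBlDr -ltrBlDl lt_min => /andP[l1 l2] l3.
set c := lam + (1 - p); have c0 : 1 / 2 < c by rewrite /c; lra.
have c0' : 0 < c by lra.
set del := 2 * (lam / c) - 1.
have delE : del = (lam - (1 - p)) / c by rewrite /del /c; field; rewrite gt_eqF.
have del_ge : p / 4 <= del by rewrite delE ler_pdivlMr// /c; nra.
have del0 : 0 < del by lra.
have deli : del^-1 <= 4 / p.
  have -> : 4 / p = (p / 4)^-1 by rewrite invf_div.
  by rewrite lef_pV2 ?posrE//; lra.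
have deli2 : (del ^+ 2)^-1 <= (4 / p) ^+ 2.
  by rewrite -exprVn lerXn2r// nnegrE ?invr_ge0 ?divr_ge0// ltW.
have p4 : 0 <= (4 / p) ^+ 2 by rewrite exprn_ge0// divr_ge0// ltW.
have dC : 6 * drift_bound (lam / c) / del ^+ 2 <= C.
  rewrite /C; apply: ler_pM => //.
  - by rewrite mulr_ge0// addr_ge0// divr_ge0// exprn_ge0// ltW.
  - by rewrite invr_ge0 exprn_ge0// ltW.
  by rewrite /drift_bound -/del; lra.
have h1 : nu.+1%:R * ((1 - lam) / c) <= e / 2.
  have : (1 - lam) / c <= 2 * (1 - lam) by rewrite ler_pdivrMr//; nra.
  move=> /(ler_wpM2l (ltW nu0)).
  have : (1 - lam) * nu.+1%:R <= e / 2 / 2.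
    by rewrite -ler_pdivlMr// mulrAC ltW.
  lra.
have h2 : 6 * drift_bound (lam / c) / (del ^+ 2 * nu.+1%:R) <= e / 2.
  rewrite invfM mulrA ler_pdivrMr//; apply: le_trans dC _.
  by rewrite mulrC -ler_pdivrMr// divr_gt0.
by apply: le_trans (lerD h1 h2) _; lra.
Qed.
End heavy_traffic.

Theorem theorem2 (R : realType) (p : R) (hp : 0 < p < 1)
    (model : R -> queue_model R)
    (hmodel : forall lambda : R, 0 < lambda < 1 ->
       is_queue p lambda (model lambda)) :
  (forall lambda : R, 1 - p < lambda < 1 ->
     feasible_policy p lambda (model lambda) (no_job_left_behind R) /\
     cost (model lambda) (no_job_left_behind R) =
       ((1 - p) / (lambda - (1 - p)))%:E) /\
  [/\ forall lambda : R, 1 - p < lambda < 1 ->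
        lookahead_policy p lambda (model lambda) +oo%E
          (no_job_left_behind R),
      cost (model lambda) (no_job_left_behind R) @[lambda --> 1^'-] -->
        ((1 - p) / p)%:E &
      optimal_cost p lambda (model lambda) +oo%E @[lambda --> 1^'-] -->
        ((1 - p) / p)%:E].
Proof.
have hq lam : 1 - p < lam < 1 -> is_queue p lam (model lam).
  move=> /andP[l1 l2]; apply: hmodel; rewrite l2 andbT.
  by case/andP: hp => _ p1; apply: lt_trans l1; rewrite subr_gt0.
have stable d lam : 0 < d <= p -> 1 - d < lam < 1 -> 1 - p < lam < 1.
  by move=> /andP[_ dp] /andP[l1 ->]; rewrite andbT (le_lt_trans _ l1)// lerD2l lerN2.
split=> [lam hlam|]; first by split; [exact: nob_feasible (hq _ hlam)|exact: nob_cost (hq _ hlam)].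
split=> [lam hlam||]; first exact: nob_lookahead (hq _ hlam).
- apply: cvge_near_cst => e e0; have [d d0 hd] := optimal_backlog_near hp e0.
  apply: (@near_left1 _ d); first by case/andP: d0.
  move=> lam hlam; have hlam' := stable _ _ d0 hlam.
  rewrite (nob_cost hp hlam' (hq _ hlam')) !lee_fin; have /andP[h1 ->] := hd lam hlam.
  by rewrite andbT; apply: le_trans h1; lra.
- apply: cvge_near_cst => e e0; have [d d0 hd] := optimal_backlog_near hp e0.
  have [nu nu0 [d' d'0 hd']] := penalty_near hp e0.
  apply: (@near_left1 _ (Num.min d d')).
    by rewrite lt_min; case/andP: d0 => ->; case/andP: d'0.
  move=> lam hlam.
  have [hl hl'] : 1 - d < lam < 1 /\ 1 - d' < lam < 1.
    move: hlam => /andP[]; rewrite ltrBlDr -ltrBlDl lt_min => /andP[l1 l2] l3.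
    by rewrite !l3 !andbT; split; lra.
  have hlam' := stable _ _ d0 hl; have /andP[h1 h2] := hd lam hl.
  apply/andP; split; last first.
    by apply: le_trans (optimal_cost_le hp hlam' (hq _ hlam')) _; rewrite lee_fin.
  apply: le_trans (optimal_cost_ge hp hlam' (hq _ hlam') +oo%E nu0).
  by rewrite lee_fin; move: (hd' lam hl'); lra.
Qed.
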